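(* If $W$ is a Segal space, then $\mathrm{Tw}\,W$ is also a Segal space.
   Context: A space means a simplicial set, and a simplicial space is a functor $X\colon \Delta^{op}\to \mathrm{sSet}$, where $\Delta$ is the simplex category; $X_n$ denotes the space $X([n])$. Write $X_{kl}$ for the set of $l$-simplices of $X_k$. Simplicial spaces are enriched in spaces by $\mathrm{Map}(X,Y)_n=\mathrm{Hom}(X\times\Delta[n],Y)$, with $\Delta[n]$ regarded as a constant simplicial space. $F(n)$ is the simplicial space with $F(n)_{kl}=\mathrm{Hom}_\Delta([k],[n])$ for all $l$, and $\partial F(n)_{kl}=\partial\Delta[n]_k$. $G(n)\subseteq F(n)$ is the sub-simplicial space of all $\varphi\colon[k]\to[n]$ with $\varphi(k)-\varphi(0)\le 1$. A Segal space is a simplicial space $W$ that is Reedy fibrant, i.e. $\mathrm{Map}(F(n),W)\to\mathrm{Map}(\partial F(n),W)$ is a Kan fibration for all $n\ge0$, and such that for all $n\ge2$ the map $W_n\cong\mathrm{Map}(F(n),W)\to\mathrm{Map}(G(n),W)\cong W_1\times_{W_0}\cdots\times_{W_0}W_1$ ($n$ factors) induced by $G(n)\hookrightarrow F(n)$ is a Kan equivalence (weak homotopy equivalence of simplicial sets). Twisted arrow construction: let $Q\colon\Delta\to\Delta$ be the functor $Q([n])=[n]^{op}\star[n]\cong[2n+1]$, $Q(\alpha)=\alpha^{op}\star\alpha$, where $\star$ is the join of posets. The twisted arrow construction $\mathrm{Tw}$ on simplicial spaces is (up to natural isomorphism) the precomposition functor $Q^*$, so $\mathrm{Tw}(W)_n=W_{2n+1}$.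 *)

(* Defs.v *)
From HB Require Import structures.
From mathcomp Require Import all_boot.
From mathcomp Require Import boolp.

Set Implicit Arguments.
Unset Strict Implicit.
Unset Printing Implicit Defensive.

(** The object [n] = {0 < ... < n} of Delta is represented by [n : nat], its
    elements being those of ['I_n.+1]. *)
Record dhom (m n : nat) := DHom {
  dfun :> {ffun 'I_m.+1 -> 'I_n.+1};
  dmonob : [forall i : 'I_m.+1, forall j : 'I_m.+1, (i <= j) ==> (dfun i <= dfun j)] }.

HB.instance Definition _ m n := [isSub of dhom m n for @dfun m n].

Definition monotone m n (f : 'I_m.+1 -> 'I_n.+1) :=
  forall i j : 'I_m.+1, i <= j -> f i <= f j.

Lemma dmono m n (a : dhom m n) : monotone a.
Proof.
by case: a => a /= /'forall_forallP H i j; apply/implyP.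
Qed.

Lemma mk_dhom_subproof m n (f : 'I_m.+1 -> 'I_n.+1) : monotone f ->
  [forall i : 'I_m.+1, forall j : 'I_m.+1, (i <= j) ==> (finfun f i <= finfun f j)].
Proof.
by move=> mf; apply/'forall_forallP => i j; apply/implyP; rewrite !ffunE; exact: mf.
Qed.

Definition mk_dhom m n (f : 'I_m.+1 -> 'I_n.+1) (mf : monotone f) : dhom m n :=
  DHom (mk_dhom_subproof mf).

Lemma mk_dhomE m n (f : 'I_m.+1 -> 'I_n.+1) (mf : monotone f) :
  mk_dhom mf =1 f.
Proof. by move=> i; rewrite ffunE. Qed.

Lemma dhom_ext m n (a b : dhom m n) : a =1 b -> a = b.
Proof. by move=> ab; apply/val_inj/ffunP. Qed.

Lemma did_subproof n : monotone (@id 'I_n.+1).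
Proof. by []. Qed.

Definition did n : dhom n n := mk_dhom (@did_subproof n).

Lemma dcomp_subproof m n p (a : dhom n p) (b : dhom m n) :
  monotone (fun i => a (b i)).
Proof. by move=> i j ij; do 2!apply: dmono. Qed.

Definition dcomp m n p (a : dhom n p) (b : dhom m n) : dhom m p :=
  mk_dhom (dcomp_subproof a b).

Lemma didE n i : did n i = i.
Proof. exact: mk_dhomE. Qed.

Lemma dcompE m n p (a : dhom n p) (b : dhom m n) i : dcomp a b i = a (b i).
Proof. exact: mk_dhomE. Qed.

Lemma dcomp_idl m n (a : dhom m n) : dcomp (did n) a = a.
Proof. by apply: dhom_ext => i; rewrite dcompE didE. Qed.

Lemma dcomp_idr m n (a : dhom m n) : dcomp a (did m) = a.
Proof. by apply: dhom_ext => i; rewrite dcompE didE. Qed.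

Lemma dcompA m n p q (a : dhom p q) (b : dhom n p) (c : dhom m n) :
  dcomp a (dcomp b c) = dcomp (dcomp a b) c.
Proof. by apply: dhom_ext => i; rewrite !dcompE. Qed.

Record dfunctor := DFunctor {
  fobj :> nat -> nat;
  fmap : forall m n, dhom m n -> dhom (fobj m) (fobj n);
  fmap_id : forall n, fmap (did n) = did (fobj n);
  fmap_comp : forall m n p (a : dhom n p) (b : dhom m n),
    fmap (dcomp a b) = dcomp (fmap a) (fmap b) }.

Record sset := SSet {
  simp :> nat -> Type;
  act : forall m n, dhom m n -> simp n -> simp m;
  act_id : forall n (x : simp n), act (did n) x = x;
  act_comp : forall m n p (a : dhom n p) (b : dhom m n) (x : simp p),
    act (dcomp a b) x = act b (act a x) }.

Record smap (X Y : sset) := SMap {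
  sfun :> forall n, X n -> Y n;
  sfun_act : forall m n (a : dhom m n) (x : X n),
    sfun (act a x) = act a (sfun x) }.

Lemma smap_ext (X Y : sset) (f g : smap X Y) :
  (forall n (x : X n), f n x = g n x) -> f = g.
Proof.
case: f g => [f fP] [g gP] /= fg.
have E : f = g.
  by apply: functional_extensionality_dep => n; apply: funext => x; exact: fg.
by rewrite E in fP *; congr SMap; exact: Prop_irrelevance.
Qed.

Definition smap_id (X : sset) : smap X X :=
  @SMap X X (fun _ x => x) (fun _ _ _ _ => erefl).

Lemma smap_comp_subproof (X Y Z : sset) (g : smap Y Z) (f : smap X Y) m n
  (a : dhom m n) (x : X n) : g m (f m (act a x)) = act a (g n (f n x)).
Proof. by rewrite !sfun_act. Qed.

Definition smap_comp (X Y Z : sset) (g : smap Y Z) (f : smap X Y) : smap X Z :=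
  SMap (smap_comp_subproof g f).

Definition spoint : sset :=
  @SSet (fun _ => unit) (fun _ _ _ x => x) (fun _ _ => erefl)
        (fun _ _ _ _ _ _ => erefl).

Definition to_spoint (X : sset) : smap X spoint :=
  @SMap X spoint (fun _ _ => tt) (fun _ _ _ _ => erefl).

Section Product.
Variables X Y : sset.

Let pact m n (a : dhom m n) (x : X n * Y n) := (act a x.1, act a x.2).

Lemma sprod_id_subproof n (x : X n * Y n) : pact (did n) x = x.
Proof. by case: x => x y; rewrite /pact !act_id. Qed.

Lemma sprod_comp_subproof m n p (a : dhom n p) (b : dhom m n) (x : X p * Y p) :
  pact (dcomp a b) x = pact b (pact a x).
Proof. by rewrite /pact !act_comp. Qed.

Definition sprod : sset :=
  @SSet (fun n => (X n * Y n)%type) pact sprod_id_subproof sprod_comp_subproof.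

End Product.

Lemma sprod_map_subproof (X X' Y Y' : sset) (f : smap X X') (g : smap Y Y')
  m n (a : dhom m n) (x : sprod X Y n) :
  (f m (act a x).1, g m (act a x).2) = act (s := sprod X' Y') a (f n x.1, g n x.2).
Proof. by rewrite /= !sfun_act. Qed.

Definition sprod_map (X X' Y Y' : sset) (f : smap X X') (g : smap Y Y') :
    smap (sprod X Y) (sprod X' Y') :=
  @SMap (sprod X Y) (sprod X' Y') (fun n x => (f n x.1, g n x.2))
        (sprod_map_subproof f g).

Definition simplex (n : nat) : sset :=
  @SSet (fun k => dhom k n) (fun k l a x => dcomp x a)
        (fun k x => dcomp_idr x) (fun k l p a b x => dcompA x a b).

Lemma simplex_map_subproof m n (a : dhom m n) k l (b : dhom k l)
  (x : simplex m l) : dcomp a (act b x) = act (s := simplex n) b (dcomp a x).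
Proof. exact: dcompA. Qed.

Definition simplex_map m n (a : dhom m n) : smap (simplex m) (simplex n) :=
  @SMap (simplex m) (simplex n) (fun k x => dcomp a x)
        (simplex_map_subproof a).

Definition sub_closed (X : sset) (P : forall n, pred (X n)) :=
  forall m n (a : dhom m n) (x : X n), P n x -> P m (act a x).

Section SubSimplicialSet.
Variables (X : sset) (P : forall n, pred (X n)) (HP : sub_closed P).

Let sub_act m n (a : dhom m n) (x : {x : X n | P x}) : {x : X m | P x} :=
  exist _ (act a (sval x)) (HP a (svalP x)).

Lemma ssub_id_subproof n (x : {x : X n | P x}) : sub_act (did n) x = x.
Proof. by apply: val_inj; rewrite /= act_id. Qed.

Lemma ssub_comp_subproof m n p (a : dhom n p) (b : dhom m n)
  (x : {x : X p | P x}) : sub_act (dcomp a b) x = sub_act b (sub_act a x).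
Proof. by apply: val_inj; rewrite /= act_comp. Qed.

Definition ssub : sset :=
  @SSet (fun n => {x : X n | P x}) sub_act ssub_id_subproof ssub_comp_subproof.

Definition ssub_incl : smap ssub X :=
  @SMap ssub X (fun n x => sval x) (fun _ _ _ _ => erefl).

End SubSimplicialSet.

(** A simplex of Delta[n] is in the boundary when, as a map [k] -> [n], it is
    not surjective. *)
Definition bdry_pred n k : pred (simplex n k) :=
  fun x => [exists j, j \notin codom (x : dhom k n)].

Lemma bdry_closed n : sub_closed (@bdry_pred n).
Proof.
move=> k l a x /existsP[j jx]; apply/existsP; exists j.
by apply: contra jx => /codomP[i ->] /=; rewrite dcompE codom_f.
Qed.

Definition bdry n : sset := ssub (@bdry_closed n).

(** The horn Lambda^i[n]: the union of all faces of Delta[n] except the one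
    opposite to the vertex [i]. *)
Definition horn_pred n (i : 'I_n.+1) k : pred (simplex n k) :=
  fun x => [exists j, (j != i) && (j \notin codom (x : dhom k n))].

Lemma horn_closed n (i : 'I_n.+1) : sub_closed (@horn_pred n i).
Proof.
move=> k l a x /existsP[j /andP[ji jx]]; apply/existsP; exists j.
by rewrite ji; apply: contra jx => /codomP[p ->] /=; rewrite dcompE codom_f.
Qed.

Definition horn n (i : 'I_n.+1) : sset := ssub (@horn_closed n i).

Definition horn_incl n (i : 'I_n.+1) : smap (horn i) (simplex n) :=
  ssub_incl (@horn_closed n i).

Definition has_lifting (A B X Y : sset) (i : smap A B) (f : smap X Y) :=
  forall (u : smap A X) (v : smap B Y), smap_comp f u = smap_comp v i ->
  exists w : smap B X, smap_comp w i = u /\ smap_comp f w = v.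

Definition Kan_fibration (X Y : sset) (f : smap X Y) :=
  forall n (i : 'I_n.+2), has_lifting (@horn_incl n.+1 i) f.

Definition Kan_complex (X : sset) := Kan_fibration (to_spoint X).

Lemma smapping_id_subproof (X Z : sset) n (h : smap (sprod X (simplex n)) Z) :
  smap_comp h (sprod_map (smap_id X) (simplex_map (did n))) = h.
Proof. by apply: smap_ext => k [x y] /=; rewrite dcomp_idl. Qed.

Lemma smapping_comp_subproof (X Z : sset) m n p (a : dhom n p) (b : dhom m n)
  (h : smap (sprod X (simplex p)) Z) :
  smap_comp h (sprod_map (smap_id X) (simplex_map (dcomp a b))) =
  smap_comp (smap_comp h (sprod_map (smap_id X) (simplex_map a)))
            (sprod_map (smap_id X) (simplex_map b)).
Proof. by apply: smap_ext => k [x y] /=; rewrite dcompA. Qed.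

Definition smapping (X Z : sset) : sset :=
  @SSet (fun n => smap (sprod X (simplex n)) Z)
    (fun m n a h => smap_comp h (sprod_map (smap_id X) (simplex_map a)))
    (@smapping_id_subproof X Z) (@smapping_comp_subproof X Z).

Lemma smapping_pre_subproof (X Y Z : sset) (f : smap X Y) m n (a : dhom m n)
  (h : smapping Y Z n) :
  smap_comp (act a h) (sprod_map f (smap_id (simplex m))) =
  act (s := smapping X Z) a
    (smap_comp h (sprod_map f (smap_id (simplex n)))).
Proof. exact: smap_ext. Qed.

Definition smapping_pre (X Y : sset) (f : smap X Y) (Z : sset) :
    smap (smapping Y Z) (smapping X Z) :=
  @SMap (smapping Y Z) (smapping X Z)
    (fun n h => smap_comp h (sprod_map f (smap_id (simplex n))))
    (@smapping_pre_subproof X Y Z f).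

Definition dvertex n (i : 'I_n.+1) : dhom 0 n :=
  @mk_dhom 0 n (fun=> i) (fun _ _ _ => leqnn i).

Definition edge (X : sset) (x y : X 0) :=
  exists e : X 1, act (dvertex ord0) e = x /\ act (dvertex ord_max) e = y.

(** [same_comp x y] says that the vertices [x] and [y] have the same class in
    pi_0(X) = X_0 / (equivalence relation generated by the edges of X). *)
Inductive same_comp (X : sset) : X 0 -> X 0 -> Prop :=
| same_comp_edge x y : edge x y -> same_comp x y
| same_comp_refl x : same_comp x x
| same_comp_sym x y : same_comp x y -> same_comp y x
| same_comp_trans x y z : same_comp x y -> same_comp y z -> same_comp x z.

Definition pi0_bijective (X Y : sset) (f : smap X Y) :=
  (forall x x' : X 0, same_comp (f 0 x) (f 0 x') -> same_comp x x') /\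
  (forall y : Y 0, exists x : X 0, same_comp (f 0 x) y).

(** Weak homotopy equivalences of (arbitrary) simplicial sets: [f : X -> Y]
    induces a bijection pi_0 Map(Y, Z) -> pi_0 Map(X, Z), that is, a bijection
    [Y, Z] -> [X, Z] of homotopy classes, for every Kan complex Z. *)
Definition Kan_equivalence (X Y : sset) (f : smap X Y) :=
  forall Z : sset, Kan_complex Z -> pi0_bijective (smapping_pre f Z).

(** For [X : sspace], the type [X k l] is the set X_{kl} of [l]-simplices of
    the space X_k. *)
Record sspace := SSpace {
  space :> nat -> sset;
  sact : forall m n, dhom m n -> smap (space n) (space m);
  sact_id : forall n l (x : space n l), sact (did n) l x = x;
  sact_comp : forall m n p (a : dhom n p) (b : dhom m n) l (x : space p l),
    sact (dcomp a b) l x = sact b l (sact a l x) }.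

Record ssmap (X Y : sspace) := SSMap {
  ssfun :> forall n, smap (X n) (Y n);
  ssfun_act : forall m n (a : dhom m n) l (x : X n l),
    ssfun m l (sact X a l x) = sact Y a l (ssfun n l x) }.

Lemma ssmap_ext (X Y : sspace) (f g : ssmap X Y) :
  (forall n l (x : X n l), f n l x = g n l x) -> f = g.
Proof.
case: f g => [f fP] [g gP] /= fg.
have E : f = g.
  by apply: functional_extensionality_dep => n; apply: smap_ext => l x; exact: fg.
by rewrite E in fP *; congr SSMap; exact: Prop_irrelevance.
Qed.

Definition ssmap_id (X : sspace) : ssmap X X :=
  @SSMap X X (fun n => smap_id (X n)) (fun _ _ _ _ _ => erefl).

Lemma ssmap_comp_subproof (X Y Z : sspace) (g : ssmap Y Z) (f : ssmap X Y) m n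
  (a : dhom m n) l (x : X n l) :
  smap_comp (g m) (f m) l (sact X a l x) =
  sact Z a l (smap_comp (g n) (f n) l x).
Proof. by rewrite /= !ssfun_act. Qed.

Definition ssmap_comp (X Y Z : sspace) (g : ssmap Y Z) (f : ssmap X Y) :
    ssmap X Z :=
  SSMap (ssmap_comp_subproof g f).

Section SSProduct.
Variables X Y : sspace.

Let psact m n (a : dhom m n) := sprod_map (sact X a) (sact Y a).

Lemma ssprod_id_subproof n l (x : sprod (X n) (Y n) l) : psact (did n) l x = x.
Proof. by case: x => x y; rewrite /= !sact_id. Qed.

Lemma ssprod_comp_subproof m n p (a : dhom n p) (b : dhom m n) l
  (x : sprod (X p) (Y p) l) : psact (dcomp a b) l x = psact b l (psact a l x).
Proof. by rewrite /= !sact_comp. Qed.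

Definition ssprod : sspace :=
  @SSpace (fun n => sprod (X n) (Y n)) psact ssprod_id_subproof
          ssprod_comp_subproof.

End SSProduct.

Lemma ssprod_map_subproof (X X' Y Y' : sspace) (f : ssmap X X') (g : ssmap Y Y')
  m n (a : dhom m n) l (x : ssprod X Y n l) :
  sprod_map (f m) (g m) l (sact (ssprod X Y) a l x) =
  sact (ssprod X' Y') a l (sprod_map (f n) (g n) l x).
Proof. by rewrite /= !ssfun_act. Qed.

Definition ssprod_map (X X' Y Y' : sspace) (f : ssmap X X') (g : ssmap Y Y') :
    ssmap (ssprod X Y) (ssprod X' Y') :=
  @SSMap (ssprod X Y) (ssprod X' Y') (fun n => sprod_map (f n) (g n))
         (ssprod_map_subproof f g).

(** A space as a constant simplicial space: (const_ss K)_{kl} = K_l. *)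
Definition const_ss (K : sset) : sspace :=
  @SSpace (fun=> K) (fun _ _ _ => smap_id K) (fun _ _ _ => erefl)
          (fun _ _ _ _ _ _ _ => erefl).

Definition const_ss_map (K L : sset) (f : smap K L) :
    ssmap (const_ss K) (const_ss L) :=
  @SSMap (const_ss K) (const_ss L) (fun=> f) (fun _ _ _ _ _ => erefl).

(** A simplicial set as a levelwise discrete simplicial space:
    (disc_ss K)_{kl} = K_k. *)
Definition disc (T : Type) : sset :=
  @SSet (fun=> T) (fun _ _ _ x => x) (fun _ _ => erefl)
        (fun _ _ _ _ _ _ => erefl).

Definition disc_map (T U : Type) (f : T -> U) : smap (disc T) (disc U) :=
  @SMap (disc T) (disc U) (fun=> f) (fun _ _ _ _ => erefl).

Definition disc_ss (K : sset) : sspace :=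
  @SSpace (fun k => disc (K k)) (fun m n a => disc_map (@act K m n a))
          (fun n _ => @act_id K n) (fun m n p a b _ => @act_comp K m n p a b).

Definition disc_ss_map (K L : sset) (f : smap K L) :
    ssmap (disc_ss K) (disc_ss L) :=
  @SSMap (disc_ss K) (disc_ss L) (fun k => disc_map (f k))
         (fun m n a _ => @sfun_act K L f m n a).

Lemma Map_id_subproof (X Y : sspace) n
  (h : ssmap (ssprod X (const_ss (simplex n))) Y) :
  ssmap_comp h
    (ssprod_map (ssmap_id X) (const_ss_map (simplex_map (did n)))) = h.
Proof. by apply: ssmap_ext => k l [x y] /=; rewrite dcomp_idl. Qed.

Lemma Map_comp_subproof (X Y : sspace) m n p (a : dhom n p) (b : dhom m n)
  (h : ssmap (ssprod X (const_ss (simplex p))) Y) :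
  ssmap_comp h
    (ssprod_map (ssmap_id X) (const_ss_map (simplex_map (dcomp a b)))) =
  ssmap_comp
    (ssmap_comp h (ssprod_map (ssmap_id X) (const_ss_map (simplex_map a))))
    (ssprod_map (ssmap_id X) (const_ss_map (simplex_map b))).
Proof. by apply: ssmap_ext => k l [x y] /=; rewrite dcompA. Qed.

(** Map(X, Y)_n = Hom(X x Delta[n], Y), with Delta[n] constant. *)
Definition Map (X Y : sspace) : sset :=
  @SSet (fun n => ssmap (ssprod X (const_ss (simplex n))) Y)
    (fun m n a h =>
       ssmap_comp h (ssprod_map (ssmap_id X) (const_ss_map (simplex_map a))))
    (@Map_id_subproof X Y) (@Map_comp_subproof X Y).

Lemma Map_pre_subproof (A B Y : sspace) (i : ssmap A B) m n (a : dhom m n)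
  (h : Map B Y n) :
  ssmap_comp (act a h) (ssprod_map i (ssmap_id (const_ss (simplex m)))) =
  act (s := Map A Y) a
    (ssmap_comp h (ssprod_map i (ssmap_id (const_ss (simplex n))))).
Proof. exact: ssmap_ext. Qed.

Definition Map_pre (A B : sspace) (i : ssmap A B) (Y : sspace) :
    smap (Map B Y) (Map A Y) :=
  @SMap (Map B Y) (Map A Y)
    (fun n h => ssmap_comp h (ssprod_map i (ssmap_id (const_ss (simplex n)))))
    (@Map_pre_subproof A B Y i).

Definition F (n : nat) : sspace := disc_ss (simplex n).

Definition bdryF (n : nat) : sspace := disc_ss (bdry n).

Definition bdryF_incl n : ssmap (bdryF n) (F n) :=
  disc_ss_map (ssub_incl (@bdry_closed n)).

(** The subtraction is not truncated here, since [x] is monotone. *)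
Definition G_pred n k : pred (simplex n k) :=
  fun x => (x : dhom k n) ord_max - (x : dhom k n) ord0 <= 1.

Lemma G_closed n : sub_closed (@G_pred n).
Proof.
move=> k l a x; rewrite /G_pred /= !dcompE; apply: leq_trans.
by apply: leq_sub; apply: dmono => //; rewrite leq_ord.
Qed.

Definition G (n : nat) : sspace := disc_ss (ssub (@G_closed n)).

Definition G_incl n : ssmap (G n) (F n) :=
  disc_ss_map (ssub_incl (@G_closed n)).

Definition Reedy_fibrant (W : sspace) :=
  forall n, Kan_fibration (Map_pre (bdryF_incl n) W).

Definition Segal_space (W : sspace) :=
  Reedy_fibrant W /\
  forall n, 2 <= n -> Kan_equivalence (Map_pre (G_incl n) W).

(** [n]^op is identified with [n] by the order-reversing [rev_ord]. *)
Lemma dop_subproof m n (a : dhom m n) :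
  monotone (fun i => rev_ord (a (rev_ord i))).
Proof. by move=> i j ij /=; rewrite leq_sub2l // ltnS dmono //= leq_sub2l. Qed.

Definition dop m n (a : dhom m n) : dhom m n := mk_dhom (dop_subproof a).

(** The join of posets [m] * [n] is [m + n + 1], with underlying set
    ['I_(m.+1 + n.+1)]: [m] is embedded by [lshift], [n] by [rshift], and
    every element of [m] is below every element of [n]. *)
Definition join_obj (m n : nat) : nat := m + n.+1.

Definition join_fun m n m' n' (a : dhom m m') (b : dhom n n')
    (i : 'I_(m.+1 + n.+1)) : 'I_(m'.+1 + n'.+1) :=
  match split i with
  | inl j => lshift n'.+1 (a j)
  | inr j => rshift m'.+1 (b j)
  end.

Lemma djoin_subproof m n m' n' (a : dhom m m') (b : dhom n n') :
  @monotone (join_obj m n) (join_obj m' n') (join_fun a b).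
Proof.
suff H (i j : 'I_(m.+1 + n.+1)) : i <= j -> join_fun a b i <= join_fun a b j.
  exact: H.
rewrite /join_fun; case: (split_ordP i) => i' ->; case: (split_ordP j) => j' -> ij.
- exact: dmono.
- by rewrite /= ltnW // (leq_trans (ltn_ord _)) // leq_addr.
- have := leq_ltn_trans (leq_trans (leq_addr i' m.+1) ij) (ltn_ord j').
  by rewrite ltnn.
- by rewrite /= leq_add2l dmono //; rewrite /= leq_add2l in ij.
Qed.

Definition djoin m n m' n' (a : dhom m m') (b : dhom n n') :
    dhom (join_obj m n) (join_obj m' n') :=
  mk_dhom (djoin_subproof a b).

Lemma join_funE m n m' n' (a : dhom m m') (b : dhom n n') i :
  djoin a b i = join_fun a b i.
Proof. exact: mk_dhomE. Qed.

Lemma join_fun_lshift m n m' n' (a : dhom m m') (b : dhom n n') i :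
  join_fun a b (lshift n.+1 i) = lshift n'.+1 (a i).
Proof. by rewrite /join_fun (unsplitK (inl _)). Qed.

Lemma join_fun_rshift m n m' n' (a : dhom m m') (b : dhom n n') i :
  join_fun a b (rshift m.+1 i) = rshift m'.+1 (b i).
Proof. by rewrite /join_fun (unsplitK (inr _)). Qed.

Lemma dopE m n (a : dhom m n) i : dop a i = rev_ord (a (rev_ord i)).
Proof. exact: mk_dhomE. Qed.

Lemma Q_id_subproof n : djoin (dop (did n)) (did n) = did (join_obj n n).
Proof.
apply: dhom_ext => i; rewrite join_funE didE.
suff H (j : 'I_(n.+1 + n.+1)) : join_fun (dop (did n)) (did n) j = j by exact: H.
case: (split_ordP j) => k ->; rewrite ?join_fun_lshift ?join_fun_rshift ?didE //.
by rewrite dopE didE rev_ordK.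
Qed.

Lemma Q_comp_subproof m n p (a : dhom n p) (b : dhom m n) :
  djoin (dop (dcomp a b)) (dcomp a b) =
  dcomp (djoin (dop a) a) (djoin (dop b) b).
Proof.
apply: dhom_ext => i; rewrite dcompE !join_funE.
suff H (j : 'I_(m.+1 + m.+1)) : join_fun (dop (dcomp a b)) (dcomp a b) j =
    join_fun (dop a) a (join_fun (dop b) b j) by exact: H.
case: (split_ordP j) => k ->.
  by rewrite !join_fun_lshift !dopE dcompE rev_ordK.
by rewrite !join_fun_rshift dcompE.
Qed.

(** The functor [n] |-> [n]^op * [n] = [2n + 1]. *)
Definition Q : dfunctor :=
  @DFunctor (fun n => join_obj n n) (fun m n a => djoin (dop a) a)
            Q_id_subproof Q_comp_subproof.

Lemma precomp_id_subproof (q : dfunctor) (W : sspace) n l (x : W (q n) l) :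
  sact W (fmap q (did n)) l x = x.
Proof. by rewrite fmap_id sact_id. Qed.

Lemma precomp_comp_subproof (q : dfunctor) (W : sspace) m n p (a : dhom n p)
  (b : dhom m n) l (x : W (q p) l) :
  sact W (fmap q (dcomp a b)) l x =
  sact W (fmap q b) l (sact W (fmap q a) l x).
Proof. by rewrite fmap_comp sact_comp. Qed.

Definition precomp (q : dfunctor) (W : sspace) : sspace :=
  @SSpace (fun n => W (q n)) (fun m n a => sact W (fmap q a))
          (@precomp_id_subproof q W) (@precomp_comp_subproof q W).

Definition Tw (W : sspace) : sspace := precomp Q W.

(* Main.v *)
Require Import Defs.
From mathcomp Require Import all_boot.
From mathcomp Require Import zify boolp.
From mathcomp Require classical_sets.

Set Implicit Arguments.
Unset Strict Implicit.
Unset Printing Implicit Defensive.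

(** Maps from a simplicial set [P], regarded as a levelwise discrete simplicial
    space, to [Tw W] are maps from the left Kan extension of [P] along [Q] to [W].
    For a subcomplex [P] of [Delta[n]] this Kan extension is the subcomplex of
    [Delta[2n+1]] that consists of the simplices [Q(d) y] with [d] in [P]
    ([Q_extension_sub]), because [Q] preserves intersections of faces. Hence the
    two conditions on [Tw W] are conditions on the maps from [W_{2n+1}] to the
    mapping spaces out of the images of the boundary and of the spine of [Delta[n]]
    ([Tw_Kan_fibration], [Tw_Kan_equivalence]).

    For the Reedy condition, it suffices that restriction along any monomorphism
    of simplicial sets is a Kan fibration on mapping spaces to a Reedy fibrant
    [W] ([Reedy_mono]). As the lifting problem is symmetric in the two simplicial
    directions, this is the fact that lifting against the inclusions of
    boundaries implies lifting against all monomorphisms ([mono_lifting]).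

    For the Segal condition, let 0, ..., n denote the elements of [[n]] and
    0', ..., n' those of [[n]^op], so that the vertices of [Delta[2n+1]] are
    n' < ... < 0' < 0 < ... < n. The image of the spine is the union of the
    tetrahedra with vertices (i+1)', i', i, i+1. It contains the spine of
    [Delta[2n+1]], and arises from it by attaching the tetrahedra for
    i = 0, ..., n-1 in turn, each along its own spine: the edge from i' to i is
    the outer edge of the previous tetrahedron, or belongs to the spine if
    i = 0. On mapping spaces each step is a pullback of the Segal map of [W_3],
    and the composite of all of them with the map in question is the Segal map
    of [W_{2n+1}]. By two-out-of-three, it remains to see that the pullbacks of
    the Segal map of [W_3] are again Kan equivalences ([tetras_Kan_equivalence]).

    Here Kan equivalences are defined by homotopy classes of maps to Kan
    complexes, a definition that says nothing about pullbacks. A Kan fibration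
    between Kan complexes which is a Kan equivalence is however [shrinkable]: it
    has a section and a fibrewise deformation onto it
    ([Kan_equivalence_shrinkable], a form of Dold's theorem). This property passes
    to pullbacks ([pushout_shrinkable]) and implies being a Kan equivalence
    ([shrinkable_Kan_equivalence]). Dold's theorem rests on the lifting of
    homotopies relative to a monomorphism ([mono_homotopy_ext]), which follows
    from the decomposition of the prisms [Delta[m] x Delta[1]] into horn fillings
    and from [mono_lifting] again. *)

(** * Maps of simplicial sets *)

Lemma smapE (X Y : sset) (f g : smap X Y) : f = g -> forall n x, f n x = g n x.
Proof. by move=> ->. Qed.

(** Maps given by case distinctions are easier to define as relations, whose
    compatibility with the action needs no transport along the cases. *)
Lemma smap_of_graph (X Y : sset) (R : forall n, X n -> Y n -> Prop) :
  (forall n x, exists y, R n x y) ->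
  (forall n x y y', R n x y -> R n x y' -> y = y') ->
  (forall m n (a : dhom m n) x y, R n x y -> R m (act a x) (act a y)) ->
  exists f : smap X Y, forall n x, R n x (f n x).
Proof.
move=> tot fct cl.
pose f n x := sval (cid (tot n x)).
have fP n x : R n x (f n x) := svalP (cid (tot n x)).
have fact m n (a : dhom m n) x : f m (act a x) = act a (f n x).
  by apply: fct (fP _ _) _; apply: cl.
by exists (SMap fact).
Qed.

Definition smono (X Y : sset) (f : smap X Y) := forall n, injective (f n).

Lemma ssub_ext (X : sset) (P : forall n, pred (X n)) (HP : sub_closed P) n
  (x y : ssub HP n) : sval x = sval y -> x = y.
Proof. exact: val_inj. Qed.

Lemma ssub_incl_mono (X : sset) (P : forall n, pred (X n)) (HP : sub_closed P) :
  smono (ssub_incl HP).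
Proof. by move=> n x y; exact: ssub_ext. Qed.

Section Corestriction.
Variables (X Z : sset) (P : forall n, pred (X n)) (HP : sub_closed P).
Variables (f : smap Z X) (Pf : forall n (z : Z n), P (f n z)).

Let cor n (z : Z n) : ssub HP n := exist _ (f n z) (Pf z).

Lemma ssub_cor_subproof m n (a : dhom m n) z : cor (act a z) = act a (cor z).
Proof. by apply: ssub_ext; rewrite /= sfun_act. Qed.

Definition ssub_cor : smap Z (ssub HP) := SMap ssub_cor_subproof.

End Corestriction.

Lemma has_liftingP (A B X Y : sset) (i : smap A B) (f : smap X Y) :
  has_lifting i f <->
  forall (u : smap A X) (v : smap B Y),
    (forall n x, f n (u n x) = v n (i n x)) ->
  exists w : smap B X, (forall n x, w n (i n x) = u n x) /\
                       (forall n y, f n (w n y) = v n y).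
Proof.
split=> H u v E.
  have [|w [wu wv]] := H u v; first exact: smap_ext.
  by exists w; split=> n x; [exact: (smapE wu) | exact: (smapE wv)].
have [|w [wu wv]] := H u v; first by move=> n x; exact: (smapE E).
by exists w; split; apply: smap_ext.
Qed.

(** * Maps of the simplex category *)

Lemma dhom_of_set n (S : {set 'I_n.+1}) j : j \in S ->
  exists m (s : dhom m n),
    [/\ m < #|S|, injective s & forall i, (i \in codom s) = (i \in S)].
Proof.
move=> jS; have S0 : 0 < #|S| by apply/card_gt0P; exists j.
have sz : size (enum S) = #|S|.-1.+1 by rewrite -cardE prednK.
have srt : sorted (fun a b : 'I_n.+1 => a < b) (enum S).
  rewrite {1}/enum_mem -enumT; apply: sorted_filter; first by move=> a b c; apply: ltn_trans.
  have : sorted ltn (map val (enum 'I_n.+1)) by rewrite val_enum_ord iota_ltn_sorted.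
  by rewrite sorted_map.
pose f (i : 'I_(#|S|.-1.+1)) := nth j (enum S) i.
have idxS (i : 'I_(#|S|.-1.+1)) : i < size (enum S) by rewrite sz.
have lt_f (i i' : 'I_(#|S|.-1.+1)) : i < i' -> f i < f i'.
  apply: (sorted_ltn_nth _ j srt); rewrite ?inE ?idxS //.
  by move=> a b c; apply: ltn_trans.
have fm : monotone f.
  move=> a b; rewrite leq_eqVlt => /orP[/eqP/val_inj -> //|ab].
  exact/ltnW/lt_f.
exists #|S|.-1, (mk_dhom fm); split; first by rewrite prednK.
  by move=> a b; rewrite !mk_dhomE => /eqP; rewrite nth_uniq ?enum_uniq ?idxS // => /eqP/val_inj.
move=> i; rewrite -[in RHS]mem_enum; apply/codomP/idP => [[k ->]|/(nthP j)[k kS <-]].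
  by rewrite mk_dhomE mem_nth ?idxS.
have kS' : k < #|S|.-1.+1 by rewrite -sz.
by exists (Ordinal kS'); rewrite mk_dhomE.
Qed.

Lemma dhom_lt m n (d : dhom m n) i j : d i < d j -> i < j.
Proof. by apply: contraTT; rewrite -!leqNgt => /dmono. Qed.

Lemma dhom_factor k m n (d : dhom m n) (x : dhom k n) : injective d ->
  (forall i, exists j, d j = x i) -> exists y, x = dcomp d y.
Proof.
move=> dI dx; pose y i := sval (cid (dx i)).
have yP i : d (y i) = x i := svalP (cid (dx i)).
have ym : monotone y.
  move=> i j ij; rewrite leqNgt; apply/negP => ji.
  have : d (y j) < d (y i).
    rewrite ltn_neqAle (dmono d (ltnW ji)) andbT (inj_eq val_inj) (inj_eq dI).
    by rewrite -val_eqE neq_ltn ji.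
  by rewrite !yP ltnNge (dmono x ij).
by exists (mk_dhom ym); apply: dhom_ext => i; rewrite dcompE mk_dhomE yP.
Qed.

Lemma dcomp_injl k m n (d : dhom m n) (x y : dhom k m) : injective d ->
  dcomp d x = dcomp d y -> x = y.
Proof.
move=> dI E; apply: dhom_ext => i; apply: dI.
by rewrite -!dcompE E.
Qed.

(** Any set-theoretic section of a monotone map of linear orders is monotone, so
    that it may be chosen to go through a prescribed point. *)
Lemma dhom_section k n (y : dhom k n) i : (forall j, j \in codom y) ->
  exists2 s : dhom n k, dcomp y s = did n & s (y i) = i.
Proof.
move=> ysurj; pose s j := if j == y i then i else iinv (ysurj j).
have sP j : y (s j) = j by rewrite /s; case: eqP => [->|_] //; rewrite f_iinv.
have sm : monotone s.
  move=> j j'; rewrite leq_eqVlt => /orP[/eqP/val_inj -> //|].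
  by rewrite -{1}(sP j) -{1}(sP j') => /dhom_lt/ltnW.
exists (mk_dhom sm); last by rewrite mk_dhomE /s eqxx.
by apply: dhom_ext => j; rewrite dcompE mk_dhomE didE.
Qed.

Lemma dhom_inj_ge n (y : dhom n n) : injective y -> forall i : 'I_n.+1, i <= y i.
Proof.
move=> yI [i ltin] /=; elim: i ltin => // i IH ltin.
apply: leq_ltn_trans (IH (ltnW ltin)) _.
by rewrite ltn_neqAle dmono //= andbT (inj_eq val_inj) (inj_eq yI) -val_eqE /= neq_ltn ltnSn.
Qed.

Lemma dhom_surj_id n (y : dhom n n) : (forall j, j \in codom y) -> y = did n.
Proof.
move=> ysurj; have yI : injective y.
  by apply/injectiveP/card_uniqP; rewrite size_codom; apply: eq_card => j; rewrite ysurj.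
have yI' : injective (dop y).
  by move=> i j; rewrite !dopE => /rev_ord_inj/yI/rev_ord_inj.
apply: dhom_ext => i; rewrite didE; apply/val_inj/eqP; rewrite eqn_leq dhom_inj_ge // andbT.
have := dhom_inj_ge yI' (rev_ord i); rewrite dopE rev_ordK /=.
by have := ltn_ord i; have := ltn_ord (y i); lia.
Qed.

Lemma dhom_epi_mono m n (d : dhom m n) :
  exists k (s : dhom k n) (t : dhom m k),
    [/\ d = dcomp s t, injective s, forall j, j \in codom t & k < #|codom d|].
Proof.
have [|k [s [ks sI sE]]] := @dhom_of_set n [set j in codom d] (d ord0).
  by rewrite inE codom_f.
have [|t dE] := dhom_factor (x := d) sI.
  move=> i; have : d i \in codom s by rewrite sE inE codom_f.
  by move=> /codomP[j ->]; exists j.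
exists k, s, t; split=> //; last by rewrite cardsE in ks.
move=> j; have : s j \in codom s by rewrite codom_f.
rewrite sE inE => /codomP[l]; rewrite {1}dE dcompE => /sI ->; exact: codom_f.
Qed.

Lemma dhom_nonsurj_factor m n (d : dhom m n) j : j \notin codom d ->
  exists k (s : dhom k n) (t : dhom m k), k < n /\ d = dcomp s t.
Proof.
move=> jd; have [k [s [t [dE _ _ kd]]]] := dhom_epi_mono d.
exists k, s, t; split=> //; apply: leq_trans kd _; rewrite -ltnS.
rewrite -[X in _ < X]card_ord; apply/proper_card/properP.
by split; [exact/subsetP | exists j].
Qed.

(** * Lifting against monomorphisms *)

(** A maximal partial lift, viewed as a graph between [B] and [E], is total:
    were [b] a simplex of least dimension outside of its domain, its boundary
    would be in the domain, so that the lifting property against the boundary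
    inclusion yields a value at [b], and this value extends the lift since a
    simplex outside of the domain is [b] acted on by at most one map. *)
Theorem mono_lifting (E D : sset) (p : smap E D) :
  (forall n, has_lifting (ssub_incl (@bdry_closed n)) p) ->
  forall (A B : sset) (i : smap A B), smono i -> has_lifting i p.
Proof.
move=> bp A B i iI; apply/has_liftingP => u v uv.
pose graph := forall n, B n -> E n -> Prop.
pose ok (R : graph) :=
  [/\ forall n b e e', R n b e -> R n b e' -> e = e',
      forall m n (a : dhom m n) b e, R n b e -> R m (act a b) (act a e),
      forall n b e, R n b e -> p n e = v n b
    & forall n a, R n (i n a) (u n a)].
pose T := {R : graph | ok R}.
pose le (R S : T) := forall n b e, sval R n b e -> sval S n b e.
pose R0 : graph := fun n b e => exists2 a, i n a = b & u n a = e.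
have R0ok : ok R0.
  split=> [n b e e' [a <- <-] [a' /iI -> <-] //|m n a b e [x <- <-]|n b e [a <- <-] //|n a].
    by exists (act a x); rewrite sfun_act.
  by exists a.
have [[R Rok] Rmax] : exists R, forall S, le R S -> le S R.
  have [R|R S U /asboolP RS /asboolP SU|C Ctot|R Rmax] :=
      @classical_sets.ZL_preorder T (exist _ R0 R0ok) (fun R S => `[< le R S >]);
    first exact/asboolP.
  - by apply/asboolP => n b e /RS/SU.
  - suff [U UP] : exists U, forall R, C R -> le R U by exists U => R /UP/asboolP.
    have {}Ctot R S : C R -> C S -> le R S \/ le S R.
      by move=> CR CS; case: (Ctot R S CR CS) => /asboolP; [left | right].
    pose U : graph := fun n b e => R0 n b e \/ exists2 R : T, C R & sval R n b e.
    have sub0 n b e (R : T) : R0 n b e -> sval R n b e.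
      by case=> a <- <-; case: (svalP R).
    have Uok : ok U.
      split=> [n b e e'|m n a b e|n b e|n a].
      - case=> [h|[R CR h]] [h'|[S CS h']].
        + by case: R0ok => f _ _ _; apply: f h h'.
        + by case: (svalP S) => f _ _ _; apply: f h'; exact: sub0.
        + by case: (svalP R) => f _ _ _; apply: f h _; exact: sub0.
        + case: (Ctot R S CR CS) => RS.
            by case: (svalP S) => f _ _ _; apply: f h'; exact: RS.
          by case: (svalP R) => f _ _ _; apply: f h _; exact: RS.
      - case=> [h|[R CR h]]; first by left; case: R0ok => _ c _ _; exact: c.
        by right; exists R => //; case: (svalP R) => _ c _ _; exact: c.
      - case=> [h|[R CR h]]; first by case: R0ok => _ _ q _; exact: q.
        by case: (svalP R) => _ _ q _; exact: q.
      - by left; exists a.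
    by exists (exist _ U Uok) => R CR n b e h; right; exists R.
  - by exists R => S RS; apply/asboolP; apply: (Rmax S); apply/asboolP.
have {}Rmax (S : graph) : ok S -> (forall n b e, R n b e -> S n b e) ->
    forall n b e, S n b e -> R n b e.
  by move=> Sok; apply: (Rmax (exist _ S Sok)).
have [Rf Rc Rp Ru] := Rok.
suff Rtot n : forall b, exists e, R n b e.
  have [w wP] := smap_of_graph Rtot Rf Rc.
  exists w; split=> n x; last exact: Rp (wP _ _).
  exact: Rf (wP _ _) (Ru _ _).
elim/ltn_ind: n => n IH b; apply: contrapT => nb.
have nonsurj_dom k (y : dhom k n) j : j \notin codom y -> exists e, R k (act y b) e.
  move=> /dhom_nonsurj_factor[l [s [t [ln ->]]]].
  by have [e Re] := IH l ln (act s b); exists (act t e); rewrite act_comp; exact: Rc.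
have [u' u'P] : exists u' : smap (bdry n) E, forall k y, R k (act (sval y) b) (u' k y).
  apply: (@smap_of_graph (bdry n) E (fun k y e => R k (act (sval y) b) e)).
  - by move=> k [y /= /existsP[j]]; exact: nonsurj_dom.
  - by move=> k y; exact: Rf.
  - by move=> k l a y e /(Rc _ _ a); rewrite /= act_comp.
have v'P k l (a : dhom k l) (y : simplex n l) :
    act (act a y : dhom _ _) (v n b) = act a (act (y : dhom _ _) (v n b)) by rewrite /= act_comp.
have [|w [wu wv]] := (has_liftingP _ _).1 (bp n) u' (SMap v'P).
  by move=> k y; rewrite (Rp _ _ _ (u'P k y)) sfun_act.
have wE k (y : dhom k n) : w k y = act y (w n (did n)).
  by rewrite -sfun_act /= dcomp_idl.
pose e0 := w n (did n).
have e0p : p n e0 = v n b by rewrite wv /= act_id.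
(* If [y] is onto, then one of its sections carries [act y b] back to [b], which
   is outside of the domain. *)
have agree k (y : dhom k n) e : R k (act y b) e -> e = act y e0.
  move=> Re; case: (pselect (exists j, j \notin codom y)) => [[j jy]|ysurj].
    have yb : bdry_pred (y : simplex n k) by apply/existsP; exists j.
    rewrite -wE; have /= -> := wu k (exist _ (y : simplex n k) yb).
    exact: Rf Re (u'P k (exist _ (y : simplex n k) yb)).
  case: nb; have ys j : j \in codom y.
    by apply: contrapT => jy; apply: ysurj; exists j; apply/negP.
  have [s ysE _] := dhom_section ord0 ys.
  by exists (act s e); rewrite -[b](act_id) -ysE act_comp; exact: Rc.
(* Outside of the old domain, every section of [y] is a section of [y'] as well,
   because a non-surjective endomorphism of [[n]] would send [b] into the domain. *)
have unique k (y y' : dhom k n) : act y b = act y' b -> act y e0 = act y' e0.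
  move=> yy'; case: (pselect (exists e, R k (act y b) e)) => [[e Re]|nd].
    by rewrite -(agree _ _ _ Re); apply: agree; rewrite -yy'.
  have ys j : j \in codom y by apply/negPn/negP => /nonsurj_dom.
  congr (act _ e0); apply: dhom_ext => l.
  have [s ysE sl] := dhom_section l ys.
  have y's : dcomp y' s = did n.
    apply: dhom_surj_id => j; apply/negPn/negP => /nonsurj_dom.
    by rewrite act_comp -yy' -act_comp ysE act_id.
  by rewrite -[in RHS]sl -dcompE y's didE.
pose R' : graph := fun k b' e => R k b' e \/ exists2 y : dhom k n, act y b = b' & act y e0 = e.
have R'ok : ok R'.
  split=> [k b' e e'|k l a b' e|k b' e|k a].
  - case=> [h|[y <- <-]] [h'|[y' y'b <-]]; first exact: Rf h h'.
    + by apply: agree; rewrite y'b.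
    + by symmetry; apply: agree.
    + exact/unique/esym.
  - case=> [h|[y <- <-]]; first by left; exact: Rc.
    by right; exists (dcomp y a); rewrite act_comp.
  - by case=> [/Rp//|[y <- <-]]; rewrite !sfun_act e0p.
  - by left.
apply: nb; exists e0; apply: (Rmax R' R'ok).
  by move=> k b' e h; left.
by right; exists (did n); rewrite act_id.
Qed.

(** * Gluing along a pushout *)

(** A criterion, checked on simplices, for a pushout along a monomorphism whose
    attached cells stay embedded. *)
Record pushout (A B A' B' : sset) (i : smap A B) (t : smap A A')
    (s : smap B B') (i' : smap A' B') : Prop := Pushout {
  po_comm : forall n x, s n (i n x) = i' n (t n x);
  po_monol : smono i';
  po_monor : smono s;
  po_cover : forall n z, (exists x, i' n x = z) \/ (exists y, s n y = z);
  po_meet : forall n x y, i' n x = s n y -> exists a, i n a = y }.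

Section Pushout.
Variables (A B A' B' : sset) (i : smap A B) (t : smap A A').
Variables (s : smap B B') (i' : smap A' B').
Hypothesis po : pushout i t s i'.

Lemma pushout_glue (T : sset) (f : smap A' T) (g : smap B T) :
  (forall n a, f n (t n a) = g n (i n a)) ->
  exists h : smap B' T, (forall n x, h n (i' n x) = f n x) /\
                        (forall n y, h n (s n y) = g n y).
Proof.
move=> fg.
pose R n z e := (exists2 x, i' n x = z & f n x = e) \/ (exists2 y, s n y = z & g n y = e).
have mixed n x y : i' n x = s n y -> f n x = g n y.
  move=> xy; have [a ay] := po_meet po xy.
  by rewrite -ay -fg; congr (f _ _); apply: (po_monol po); rewrite xy -ay (po_comm po).
have [||m n a z e|h hR] := @smap_of_graph B' T R.
- by move=> n z; case: (po_cover po z) => [[x <-]|[y <-]];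
    [exists (f n x); left; exists x | exists (g n y); right; exists y].
- move=> n z e e' [[x <- <-]|[y <- <-]] [[x' E <-]|[y' E <-]].
  + by rewrite (po_monol po E).
  + exact: mixed.
  + exact/esym/mixed.
  + by rewrite (po_monor po E).
- by case=> [[x <- <-]|[y <- <-]]; [left; exists (act a x) | right; exists (act a y)];
    rewrite sfun_act.
exists h; split=> n x.
  by case: (hR n (i' n x)) => [[x' /(po_monol po) -> //]|[y /esym/mixed -> //]].
by case: (hR n (s n x)) => [[x' /mixed <- //]|[y /(po_monor po) -> //]].
Qed.

Lemma pushout_joint (T : Type) n (h h' : B' n -> T) :
  (forall x, h (i' n x) = h' (i' n x)) -> (forall y, h (s n y) = h' (s n y)) -> h =1 h'.
Proof. by move=> hi hs z; case: (po_cover po z) => [[x <-]|[y <-]]. Qed.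

Lemma pushout_lifting (E D : sset) (p : smap E D) : has_lifting i p -> has_lifting i' p.
Proof.
move=> /has_liftingP ip; apply/has_liftingP => u v uv.
have [|w [wi wp]] := ip (smap_comp u t) (smap_comp v s).
  by move=> n x /=; rewrite uv (po_comm po).
have [|h [hi hs]] := @pushout_glue E u w; first by move=> n a; rewrite wi.
exists h; split=> // n; apply: pushout_joint => [x|y]; first by rewrite hi uv.
by rewrite hs wp.
Qed.

End Pushout.

(** * The homotopy extension lifting property *)

Definition dcst n p (j : 'I_p.+1) : dhom n p :=
  mk_dhom (fun i i' (_ : i <= i') => leqnn j : (fun=> j) i <= (fun=> j) i').

Lemma dcstE n p j i : dcst n j i = j :> 'I_p.+1.
Proof. exact: mk_dhomE. Qed.

Lemma dcomp_dcst m n p (j : 'I_p.+1) (a : dhom m n) : dcomp (dcst n j) a = dcst m j.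
Proof. by apply: dhom_ext => i; rewrite dcompE !dcstE. Qed.

Lemma dhom0 n (a b : dhom n 0) : a = b.
Proof. by apply: dhom_ext => i; rewrite [a i]ord1 [b i]ord1. Qed.

Definition end0 n : simplex 1 n := dcst n ord0.
Definition end1 n : simplex 1 n := dcst n ord_max.

Lemma act_end0 m n (a : dhom m n) : act a (end0 n) = end0 m.
Proof. exact: dcomp_dcst. Qed.

Definition homotopy_ext (A B E D : sset) (i : smap A B) (p : smap E D) :=
  forall (u : smap B E) (h : smap (sprod A (simplex 1)) E)
         (v : smap (sprod B (simplex 1)) D),
    (forall n a, h n (a, end0 n) = u n (i n a)) ->
    (forall n b, p n (u n b) = v n (b, end0 n)) ->
    (forall n a t, p n (h n (a, t)) = v n (i n a, t)) ->
  exists w : smap (sprod B (simplex 1)) E,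
    [/\ forall n b, w n (b, end0 n) = u n b,
        forall n a t, w n (i n a, t) = h n (a, t)
      & forall n b t, p n (w n (b, t)) = v n (b, t)].

Section Prism.
Variable m : nat.

Let X := sprod (simplex m) (simplex 1).

(** A filtration of the prism [Delta[m] x Delta[1]]: the stage [m.+1] is the open
    prism (the side walls and the bottom), the stage [0] is the whole prism, and
    the stage [j] is obtained from the stage [j.+1] by adding one shuffle. *)
Definition prism_pred (j : nat) n : pred (X n) := fun x =>
  [exists v, v \notin codom (x.1 : dhom n m)] ||
  [forall i, ((x.2 : dhom n 1) i == ord0) || (j <= (x.1 : dhom n m) i)].

Lemma prism_closed j : sub_closed (prism_pred j).
Proof.
move=> k n a x /orP[/existsP[v vx]|/forallP H]; apply/orP.
  left; apply/existsP; exists v; apply: contra vx => /codomP[l ->] /=.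
  by rewrite dcompE codom_f.
by right; apply/forallP => l; rewrite /= !dcompE.
Qed.

Definition prism j : sset := ssub (@prism_closed j).

Lemma prism_ext j n (x y : prism j n) : sval x = sval y -> x = y.
Proof. exact: (@ssub_ext _ _ (@prism_closed j)). Qed.

Section Cell.
Variable j : 'I_m.+1.

Lemma prism_degen_lt (i : 'I_m.+2) : (if i <= j then i : nat else i.-1) < m.+1.
Proof. by have := ltn_ord i; have := ltn_ord j; case: (leqP i j); lia. Qed.

Lemma prism_degen_subproof :
  monotone (fun i : 'I_m.+2 => inord (if i <= j then i : nat else i.-1) : 'I_m.+1).
Proof.
move=> i i' ii'; rewrite !inordK ?prism_degen_lt //.
by case: (leqP i j); case: (leqP i' j); lia.
Qed.

Lemma prism_up_subproof : monotone (fun i : 'I_m.+2 => inord (j < i) : 'I_2).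
Proof.
move=> i i' ii'; rewrite !inordK ?ltnS ?leq_b1 //.
by case: (ltnP j i) => // ji; rewrite (leq_trans ji ii').
Qed.

Definition prism_degen : dhom m.+1 m := mk_dhom prism_degen_subproof.
Definition prism_up : dhom m.+1 1 := mk_dhom prism_up_subproof.

Lemma prism_degenE i : prism_degen i = (if i <= j then i : nat else i.-1) :> nat.
Proof.
by rewrite mk_dhomE inordK ?prism_degen_lt.
Qed.

Lemma prism_upE i : prism_up i = (j < i) :> nat.
Proof. by rewrite mk_dhomE inordK // ltnS leq_b1. Qed.

Lemma prism_up0 i : (prism_up i == ord0) = (i <= j).
Proof.
rewrite -val_eqE; have -> : val (prism_up i) = (j < i) := prism_upE i.
by case: ltnP.
Qed.

Lemma prism_cell_subproof k n (a : dhom k n) (y : simplex m.+1 n) :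
  (dcomp prism_degen (act a y), dcomp prism_up (act a y)) =
  act (s := X) a (dcomp prism_degen y, dcomp prism_up y).
Proof. by rewrite /= !dcompA. Qed.

(** The [j]-th shuffle [(0,0) < ... < (j,0) < (j,1) < ... < (m,1)]. *)
Definition prism_cell : smap (simplex m.+1) X :=
  @SMap (simplex m.+1) X (fun n y => (dcomp prism_degen y, dcomp prism_up y))
        prism_cell_subproof.

Lemma prism_cell1 n (y : simplex m.+1 n) i :
  ((prism_cell n y).1 : dhom n m) i = prism_degen ((y : dhom n m.+1) i).
Proof. exact: dcompE. Qed.

Lemma prism_cell2 n (y : simplex m.+1 n) i :
  ((prism_cell n y).2 : dhom n 1) i = prism_up ((y : dhom n m.+1) i).
Proof. exact: dcompE. Qed.

(** Adding the two coordinates is a common retraction of all the shuffles. *)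
Lemma prism_cellK n (y : simplex m.+1 n) i :
  ((prism_cell n y).1 : dhom n m) i + ((prism_cell n y).2 : dhom n 1) i =
  (y : dhom n m.+1) i :> nat.
Proof. by rewrite prism_cell1 prism_cell2 prism_degenE prism_upE; case: ltnP => /=; lia. Qed.

Lemma prism_cell_in n (y : simplex m.+1 n) : prism_pred j (prism_cell n y).
Proof.
apply/orP; right; apply/forallP => i.
rewrite prism_cell1 prism_cell2 prism_up0 prism_degenE.
by case: leqP => //=; lia.
Qed.

(** Of the faces of the [j]-th shuffle, the one opposite to the vertex [j.+1] is
    shared with the next shuffle or is the bottom of the prism, the one opposite
    to the vertex [j] is shared with the previous shuffle or is the top, and the
    others lie in the side walls. *)
Lemma prism_cell_horn n (y : simplex m.+1 n) :
  prism_pred j.+1 (prism_cell n y) = horn_pred (inord j : 'I_m.+2) y.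
Proof.
have jv : (inord j : 'I_m.+2) = j :> nat by rewrite inordK // leqW.
apply/orP/existsP => [H|[v /andP[vj vy]]].
- apply: contrapT => hit.
  have {}hit (v : 'I_m.+2) : v != j :> nat -> exists i, (y : dhom n m.+1) i = v.
    move=> vj; apply: contrapT => nv; apply: hit; exists v.
    rewrite -val_eqE /= jv vj; apply/codomP => -[i vi]; apply: nv; by exists i.
  case: H => [/existsP[v /codomP[]]|/forallP H].
    case: (ltnP v j) => vj.
      have [|i iv] := hit (widen_ord (leqnSn _) v); first by rewrite /=; lia.
      exists i; apply: ord_inj; rewrite prism_cell1 prism_degenE iv /=.
      by rewrite ltnW.
    have [|i iv] := hit (lift ord0 v); first by rewrite /= /bump /=; lia.
    exists i; apply: ord_inj; rewrite prism_cell1 prism_degenE iv /= /bump /=.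
    by case: leqP; lia.
  have [|i iv] := hit (lift ord0 j); first by rewrite /= /bump /=; lia.
  have := H i; rewrite prism_cell1 prism_cell2 prism_up0 prism_degenE iv /= /bump /=.
  by rewrite add1n ltnn /= ltnn.
- rewrite -val_eqE /= jv in vj.
  have nv i : (y : dhom n m.+1) i != v :> nat.
    by apply: contra vy => /eqP/val_inj <-; exact: codom_f.
  have dj := ltn_ord j; have dv := ltn_ord v.
  case: (eqVneq (v : nat) j.+1) => [vj1|vj1].
    right; apply/forallP => i; rewrite prism_cell1 prism_cell2 prism_up0 prism_degenE.
    by have := nv i; case: (leqP ((y : dhom n m.+1) i) j) => //=; lia.
  left; apply/existsP.
  have ltv : (if v <= j then v : nat else v.-1) < m.+1.
    by case: (leqP v j); lia.
  exists (Ordinal ltv); apply/codomP => -[i /(congr1 (@nat_of_ord _))].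
  rewrite prism_cell1 prism_degenE /=; have := nv i.
  by case: (leqP ((y : dhom n m.+1) i) j); case: (leqP v j); lia.
Qed.

Lemma prism_sub n (x : X n) : prism_pred j.+1 x -> prism_pred j x.
Proof.
case/orP => [H|/forallP H]; apply/orP; [by left | right].
by apply/forallP => i; have /orP[->//|/ltnW ->] := H i; rewrite orbT.
Qed.

Lemma prism_new n (x : X n) : prism_pred j x -> ~~ prism_pred j.+1 x ->
  exists y, prism_cell n y = x.
Proof.
case: x => x1 x2; rewrite /prism_pred negb_or /= => /orP[-> //|/forallP Hj].
case/andP=> _; rewrite negb_forall => /existsP[i0].
rewrite negb_or -leqNgt => /andP[x2i0 x1i0].
have b2 i : (x2 : dhom n 1) i < 2 by [].
have x2i0' : (x2 : dhom n 1) i0 = 1 :> nat.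
  by have := b2 i0; move: x2i0; rewrite -val_eqE /=; lia.
have fP i : (x1 : dhom n m) i + (x2 : dhom n 1) i < m.+2.
  by have := ltn_ord ((x1 : dhom n m) i); have := b2 i; lia.
have fm : monotone (fun i => Ordinal (fP i)).
  by move=> i i' ii' /=; apply: leq_add; exact: dmono.
have x2E i : (x2 : dhom n 1) i = 0 :> nat /\ (x1 : dhom n m) i <= j \/
             (x2 : dhom n 1) i = 1 :> nat /\ j <= (x1 : dhom n m) i.
  case: (eqVneq (x2 i : nat) 0) => [x2i|x2i]; [left | right]; split=> //.
  - apply: leq_trans x1i0; apply/dmono/ltnW/(@dhom_lt _ _ x2).
    by rewrite x2i x2i0'.
  - by have := b2 i; lia.
  - by have := Hj i; rewrite -val_eqE /= (negbTE x2i).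
exists (mk_dhom fm); congr (_, _); apply: dhom_ext => i; apply: ord_inj;
  rewrite dcompE ?prism_degenE ?prism_upE mk_dhomE /=;
  case: (x2E i) => -[-> jx]; rewrite ?addn0 ?addn1.
- by rewrite jx.
- by rewrite ltnNge jx.
- by rewrite ltnNge jx.
- by rewrite ltnS jx.
Qed.

End Cell.

(** By [prism_cell_horn] each step of the filtration is a horn filling. *)
Lemma prism_lifting (E D : sset) (p : smap E D) : Kan_fibration p ->
  forall j, j <= m.+1 -> has_lifting (ssub_incl (@prism_closed j)) p.
Proof.
move=> Kp; elim=> [_|j IH jm]; apply/has_liftingP => u v uv.
  have inP n (x : X n) : prism_pred 0 (smap_id X n x).
    by apply/orP; right; apply/forallP => i; rewrite leq0n orbT.
  exists (smap_comp u (ssub_cor (@prism_closed 0) inP)); split=> n x /=.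
    by congr (u _ _); apply: prism_ext.
  by rewrite uv.
pose o : 'I_m.+1 := Ordinal jm.
have step := @prism_sub o.
have incl n (x : prism j.+1 n) : prism_pred j (ssub_incl (@prism_closed j.+1) n x).
  by apply: step; exact: (svalP x).
have hornP n (y : horn (inord o : 'I_m.+2) n) :
    prism_pred j.+1 (smap_comp (prism_cell o) (horn_incl (inord o : 'I_m.+2)) n y).
  by rewrite (prism_cell_horn o); exact: (svalP y).
have po : pushout (horn_incl (inord o : 'I_m.+2)) (ssub_cor (@prism_closed j.+1) hornP)
    (ssub_cor (@prism_closed j) (@prism_cell_in o)) (ssub_cor (@prism_closed j) incl).
  split.
  - by move=> n x; apply: prism_ext.
  - by move=> n x y /(congr1 sval) /= xy; apply: prism_ext.
  - move=> n x y /(congr1 sval) xy; apply: dhom_ext => i; apply: ord_inj.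
    rewrite -(prism_cellK o x) -(prism_cellK o y).
    by have -> : prism_cell o n x = prism_cell o n y by exact: xy.
  - move=> n z; case: (boolP (prism_pred j.+1 (sval z))) => zP.
      by left; exists (exist _ (sval z) zP); apply: prism_ext.
    have [y yz] := @prism_new o _ _ (svalP z) zP.
    by right; exists y; apply: prism_ext.
  - move=> n x y /(congr1 sval) xy.
    have yP : horn_pred (inord o : 'I_m.+2) y.
      rewrite -(prism_cell_horn o); have <- : sval x = prism_cell o n y by exact: xy.
      exact: (svalP x).
    by exists (exist _ y yP).
have [|w [wu wv]] := (has_liftingP _ _).1 (pushout_lifting po (Kp _ _)) u
    (smap_comp v (ssub_incl (@prism_closed j))).
  by move=> n x; rewrite uv.
have [w' [w'w w'v]] := (has_liftingP _ _).1 (IH (ltnW jm)) w v wv.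
exists w'; split=> // n x.
by rewrite -wu -w'w.
Qed.

Lemma prism_homotopy_ext (E D : sset) (p : smap E D) : Kan_fibration p ->
  homotopy_ext (ssub_incl (@bdry_closed m)) p.
Proof.
move=> Kp u h v hu pu ph.
pose R n (x : prism m.+1 n) e :=
  (exists2 d : bdry m n, sval d = (sval x).1 & h n (d, (sval x).2) = e) \/
  ((sval x).2 = end0 n /\ u n (sval x).1 = e).
have [|n x e e'|k n a x e|w wR] := @smap_of_graph (prism m.+1) E R.
- move=> n [[x1 x2] xP]; case/orP: (xP) => /= [xb|/forallP xb].
    by exists (h n (exist _ x1 xb, x2)); left; exists (exist _ x1 xb).
  exists (u n x1); right; split=> //=; apply: dhom_ext => i; rewrite dcstE.
  by have := xb i; rewrite leqNgt ltn_ord orbF => /eqP.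
- case=> [[d dx <-]|[x0 <-]] [[d' d'x <-]|[x0' <-]] //.
  + by congr (h _ (_, _)); apply: ssub_ext; rewrite dx.
  + by rewrite x0' hu /= dx.
  + by rewrite x0 hu /= d'x.
- case=> [[d dx <-]|[x0 <-]]; [left|right].
    by exists (act a d); rewrite -?sfun_act //= dx.
  by rewrite -sfun_act /=; split=> //; rewrite x0; exact: act_end0.
have [|w' [w'w w'v]] := (has_liftingP _ _).1 (prism_lifting Kp (leqnn _)) w v.
  move=> n x; case: (wR n x) => [[d dx <-]|[x0 <-]].
    by rewrite ph /= dx; case: x {dx} => -[].
  by rewrite pu -x0; case: x {x0} => -[].
exists w'; split=> //.
- move=> n b.
  have bP : prism_pred m.+1 ((b, end0 n) : X n).
    by apply/orP; right; apply/forallP => i; rewrite dcstE.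
  have /= -> := w'w n (exist _ ((b, end0 n) : X n) bP).
  case: (wR n (exist _ ((b, end0 n) : X n) bP)) => [[d /= db hw]|[_ hw]]; rewrite -hw //.
  by rewrite hu /= db.
- move=> n a t.
  have aP : prism_pred m.+1 ((sval a, t) : X n) by apply/orP; left; exact: (svalP a).
  have /= -> := w'w n (exist _ ((sval a, t) : X n) aP).
  case: (wR n (exist _ ((sval a, t) : X n) aP)) => [[d /= da hw]|[/= t0 hw]]; rewrite -hw.
    by congr (h _ (_, _)); apply: ssub_ext.
  by rewrite t0 hu.
Qed.

End Prism.

Lemma curry_subproof (B Z : sset) (w : smap (sprod B (simplex 1)) Z) n (b : B n)
  k l (a : dhom k l) (x : sprod (simplex 1) (simplex n) l) :
  w k (act (act a x).2 b, (act a x).1) = act a (w l (act (x.2 : dhom l n) b, x.1)).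
Proof. by rewrite -sfun_act /= act_comp. Qed.

Definition curry_at (B Z : sset) (w : smap (sprod B (simplex 1)) Z) n (b : B n) :
    smapping (simplex 1) Z n :=
  @SMap (sprod (simplex 1) (simplex n)) Z
        (fun k x => w k (act (x.2 : dhom k n) b, x.1)) (curry_subproof w b).

Lemma curry_at_act (B Z : sset) (w : smap (sprod B (simplex 1)) Z) m n
  (a : dhom m n) (b : B n) : curry_at w (act a b) = act a (curry_at w b).
Proof. by apply: smap_ext => k [t x]; rewrite /= act_comp. Qed.

Definition curry (B Z : sset) (w : smap (sprod B (simplex 1)) Z) :
    smap B (smapping (simplex 1) Z) := SMap (curry_at_act w).

Lemma uncurry_at (B Z : sset) (g : smap B (smapping (simplex 1) Z)) n (b : B n)
    k (t : simplex 1 k) (x : dhom k n) :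
  (g n b : smap _ _) k (t, x) = (g k (act x b) : smap _ _) k (t, did k).
Proof. by rewrite sfun_act /= dcomp_idr. Qed.

Lemma uncurry_subproof (B Z : sset) (g : smap B (smapping (simplex 1) Z)) m n
  (a : dhom m n) (x : sprod B (simplex 1) n) :
  (g m (act a x).1 : smap _ _) m ((act a x).2, did m) =
  act a ((g n x.1 : smap _ _) n (x.2, did n)).
Proof.
rewrite -(sfun_act (g n x.1 : smap _ _)) /=.
by rewrite sfun_act /= dcomp_idl dcomp_idr.
Qed.

Definition uncurry (B Z : sset) (g : smap B (smapping (simplex 1) Z)) :
    smap (sprod B (simplex 1)) Z :=
  @SMap (sprod B (simplex 1)) Z (fun n x => (g n x.1 : smap _ _) n (x.2, did n))
        (uncurry_subproof g).

Section PathFibration.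
Variables (E D : sset) (p : smap E D).

Definition path_base_pred n : pred (sprod E (smapping (simplex 1) D) n) :=
  fun x => `[< (x.2 : smap _ _) n (end0 n, did n) = p n x.1 >].

Lemma path_base_closed : sub_closed path_base_pred.
Proof.
move=> m n a [e h] /asboolP /= he; apply/asboolP => /=.
by rewrite sfun_act -he -sfun_act /= dcomp_idr dcomp_idl dcomp_dcst.
Qed.

(** The pullback of the evaluation at the initial vertex [D^Delta[1] -> D]
    along [p]. *)
Definition path_base : sset := ssub path_base_closed.

Definition ev0 (Z : sset) n (h : smapping (simplex 1) Z n) : Z n :=
  (h : smap _ _) n (end0 n, did n).

Lemma ev0_act (Z : sset) m n (a : dhom m n) (h : smapping (simplex 1) Z n) :
  ev0 (act a h) = act a (ev0 h).
Proof. by rewrite /ev0 -sfun_act /= dcomp_idr dcomp_idl dcomp_dcst. Qed.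

Lemma path_proj_subproof n (h : smapping (simplex 1) E n) :
  path_base_pred (n := n) (ev0 h, smap_comp p h).
Proof. exact/asboolP. Qed.

Definition path_proj_at n (h : smapping (simplex 1) E n) : path_base n :=
  exist _ (ev0 h, smap_comp p h) (path_proj_subproof h).

Lemma path_proj_act m n (a : dhom m n) (h : smapping (simplex 1) E n) :
  path_proj_at (act a h) = act a (path_proj_at h).
Proof.
apply: (@ssub_ext _ _ path_base_closed); apply: (f_equal2 pair); first exact: ev0_act.
exact: smap_ext.
Qed.

Definition path_proj : smap (smapping (simplex 1) E) path_base :=
  SMap path_proj_act.

Lemma path_proj_ext n (x y : path_base n) :
  (sval x).1 = (sval y).1 ->
  (forall k t, ((sval x).2 : smap _ _) k t = ((sval y).2 : smap _ _) k t) -> x = y.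
Proof.
case: x y => [[x1 x2] xP] [[y1 y2] yP] /= E1 E2; apply: (@ssub_ext _ _ path_base_closed) => /=.
by rewrite E1; congr (_, _); apply: smap_ext.
Qed.

Lemma path_proj_lifting (A B : sset) (i : smap A B) :
  homotopy_ext i p -> has_lifting i path_proj.
Proof.
move=> hi; apply/has_liftingP => U V UV.
pose pr1 : smap path_base E :=
  @SMap path_base E (fun n x => (sval x).1) (fun _ _ _ _ => erefl).
pose pr2 : smap path_base (smapping (simplex 1) D) :=
  @SMap path_base (smapping (simplex 1) D) (fun n x => (sval x).2) (fun _ _ _ _ => erefl).
have [n a|n b|n a t|w [w0 wi wp]] :=
    hi (smap_comp pr1 V) (uncurry U) (uncurry (smap_comp pr2 V)).
- by rewrite /= -UV.
- by rewrite /=; apply/esym; exact: (asboolP _ (svalP (V n b))).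
- by rewrite /= -UV.
exists (curry w); split=> n x.
  by apply: smap_ext => k [t y] /=; rewrite -sfun_act wi /= -uncurry_at.
apply: path_proj_ext => [|k [t y]]; first by rewrite /= /ev0 /= act_id w0.
by rewrite /= wp; exact/esym/(uncurry_at (smap_comp pr2 V)).
Qed.

Lemma homotopy_ext_of_lifting (A B : sset) (i : smap A B) :
  has_lifting i path_proj -> homotopy_ext i p.
Proof.
move=> /has_liftingP li u h v hu pu ph.
have VP n (b : B n) : path_base_pred (n := n) (u n b, curry_at v b).
  by apply/asboolP; rewrite /= act_id pu.
pose Vat n (b : B n) : path_base n := exist _ (u n b, curry_at v b) (VP n b).
have Vact m n (a : dhom m n) (b : B n) : Vat m (act a b) = act a (Vat n b).
  by apply: (@ssub_ext _ _ path_base_closed); rewrite /= sfun_act curry_at_act.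
have [n x|W [Wi Wp]] := li (curry h) (SMap Vact).
  apply: path_proj_ext => [|k [t y]]; first by rewrite /= /ev0 /= act_id hu.
  by rewrite /= ph sfun_act.
exists (uncurry W); split=> [n b|n a t|n b t].
- exact: (congr1 (fun x => (sval x).1) (Wp n b)).
- by rewrite /= Wi /= act_id.
- have WE := smapE (congr1 (fun x => (sval x).2) (Wp n b)) (t, did n).
  by rewrite [LHS]WE /= act_id.
Qed.

End PathFibration.

(** Exponential adjunction turns both the hypothesis and the conclusion into
    lifting properties of the map from paths in [E] to the pullback of paths in
    [D], to which [mono_lifting] applies. *)
Theorem mono_homotopy_ext (E D : sset) (p : smap E D) : Kan_fibration p ->
  forall (A B : sset) (i : smap A B), smono i -> homotopy_ext i p.
Proof.
move=> Kp A B i iI; apply/homotopy_ext_of_lifting/mono_lifting => // n.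
exact/path_proj_lifting/prism_homotopy_ext.
Qed.

(** * Homotopies *)

Definition sempty : sset :=
  @SSet (fun=> void) (fun _ _ _ x => x) (fun _ _ => erefl) (fun _ _ _ _ _ _ => erefl).

Definition of_sempty (X : sset) : smap sempty X :=
  @SMap sempty X (fun n x => match x with end) (fun _ _ _ x => match x with end).

Lemma of_sempty_mono X : smono (of_sempty X).
Proof. by move=> n []. Qed.

Section AtEnd.
Variables (X Z : sset) (H : smap (sprod X (simplex 1)) Z).

Lemma at_end1_subproof m n (a : dhom m n) (x : X n) :
  H m (act a x, end1 m) = act a (H n (x, end1 n)).
Proof. by rewrite -sfun_act /= dcomp_dcst. Qed.

Definition at_end1 : smap X Z := SMap at_end1_subproof.

Lemma at_end0_subproof m n (a : dhom m n) (x : X n) :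
  H m (act a x, end0 m) = act a (H n (x, end0 n)).
Proof. by rewrite -sfun_act /= dcomp_dcst. Qed.

Definition at_end0 : smap X Z := SMap at_end0_subproof.

End AtEnd.

Definition homotopic (X Z : sset) (f g : smap X Z) :=
  exists H : smap (sprod X (simplex 1)) Z, at_end0 H = f /\ at_end1 H = g.

Lemma end0_bdry n : bdry_pred (end0 n).
Proof.
apply/existsP; exists ord_max; apply/codomP => -[i] /(congr1 (@nat_of_ord _)).
by rewrite dcstE.
Qed.

Lemma end1_bdry n : bdry_pred (end1 n).
Proof.
apply/existsP; exists ord0; apply/codomP => -[i] /(congr1 (@nat_of_ord _)).
by rewrite dcstE.
Qed.

Lemma bdry1_const n (s : bdry 1 n) i : (sval s : dhom n 1) i = (sval s : dhom n 1) ord0.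
Proof.
case: s => s /= /existsP[j js].
have sj l : s l != j by apply: contra js => /eqP <-; exact: codom_f.
move: (sj i) (sj ord0) => {sj js}.
move: (s i) (s ord0) => [[|[|//]] ?] [[|[|//]] ?]; case: j => [[|[|//]] ?] //= _ _; exact: val_inj.
Qed.

(** Two homotopies with the same start and the same image in [D] are two sides
    of an open square; filling it over the degenerate square in [D] joins
    their ends by a fibrewise constant homotopy. *)
Lemma homotopy_fork (E D : sset) (p : smap E D) (X : sset)
    (al be : smap (sprod X (simplex 1)) E) : Kan_fibration p ->
  at_end0 al = at_end0 be -> smap_comp p al = smap_comp p be ->
  exists ga : smap (sprod X (simplex 1)) E,
    [/\ at_end0 ga = at_end1 al, at_end1 ga = at_end1 be
      & forall n x s, p n (ga n (x, s)) = p n (at_end1 al n x)].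
Proof.
move=> Kp ab0 pab.
pose i := sprod_map (smap_id X) (ssub_incl (@bdry_closed 1)).
have iI : smono i by move=> n [x s] [x' s'] [-> /ssub_ext ->].
pose hf n (z : sprod (sprod X (bdry 1)) (simplex 1) n) : E n :=
  if (sval z.1.2 : dhom n 1) ord0 == ord0 then al n (z.1.1, z.2) else be n (z.1.1, z.2).
have hact m n (a : dhom m n) z : hf m (act a z) = act a (hf n z).
  rewrite /hf /= dcompE bdry1_const.
  by case: ifP => _; rewrite -sfun_act.
pose h : smap (sprod (sprod X (bdry 1)) (simplex 1)) E := SMap hact.
have uact m n (a : dhom m n) (z : sprod X (simplex 1) n) :
    al m ((act a z).1, end0 m) = act a (al n (z.1, end0 n)).
  by rewrite -sfun_act /= dcomp_dcst.
pose u : smap (sprod X (simplex 1)) E := SMap uact.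
have vact m n (a : dhom m n) (z : sprod (sprod X (simplex 1)) (simplex 1) n) :
    p m (al m ((act a z).1.1, (act a z).2)) = act a (p n (al n (z.1.1, z.2))).
  by rewrite -!sfun_act.
pose v : smap (sprod (sprod X (simplex 1)) (simplex 1)) D := SMap vact.
have [n [x s]|//|n [x s] t|w [w0 wi wp]] := mono_homotopy_ext Kp iI (u := u) (h := h) (v := v).
- rewrite /= /hf /=; case: ifP => // _.
  by have /= -> := smapE ab0 x.
- rewrite /= /hf /=; case: ifP => // _.
  by have /= -> := smapE pab (x, t).
exists (at_end1 w); split=> [||n x s]; last by rewrite /= wp.
- apply: smap_ext => n x /=.
  have /= -> := wi n (x, exist _ (end0 n) (end0_bdry n)) (end1 n).
  by rewrite /hf /= dcstE eqxx.
- apply: smap_ext => n x /=.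
  have /= -> := wi n (x, exist _ (end1 n) (end1_bdry n)) (end1 n).
  by rewrite /hf /= dcstE.
Qed.

Section KanTarget.
Variables (X Z : sset) (KZ : Kan_complex Z).

Lemma homotopic_refl (f : smap X Z) : homotopic f f.
Proof.
pose pr : smap (sprod X (simplex 1)) X :=
  @SMap (sprod X (simplex 1)) X (fun n x => x.1) (fun _ _ _ _ => erefl).
by exists (smap_comp f pr); split; apply: smap_ext.
Qed.

Lemma homotopic_fork (f g h : smap X Z) : homotopic f g -> homotopic f h -> homotopic g h.
Proof.
move=> [al [al0 al1]] [be [be0 be1]].
have [||ga [ga0 ga1 _]] := homotopy_fork (al := al) (be := be) KZ; first by rewrite al0.
  exact: smap_ext.
by exists ga; rewrite ga0 ga1.
Qed.

Lemma homotopic_sym (f g : smap X Z) : homotopic f g -> homotopic g f.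
Proof. by move=> fg; apply: homotopic_fork fg (homotopic_refl f). Qed.

Lemma homotopic_trans (f g h : smap X Z) : homotopic f g -> homotopic g h -> homotopic f h.
Proof. by move=> /homotopic_sym; exact: homotopic_fork. Qed.

End KanTarget.

Definition sfst (X Y : sset) : smap (sprod X Y) X :=
  @SMap (sprod X Y) X (fun n x => x.1) (fun _ _ _ _ => erefl).

(** The vertices of [smapping X Z] are the maps from [X] to [Z], and its edges
    are the homotopies. *)
Definition vertex_of (X Z : sset) (f : smap X Z) : smapping X Z 0 :=
  smap_comp f (sfst X (simplex 0)).

Lemma map_of_subproof (X Z : sset) (a : smapping X Z 0) m n (c : dhom m n) (x : X n) :
  (a : smap _ _) m (act c x, dcst m ord0) = act c ((a : smap _ _) n (x, dcst n ord0)).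
Proof. by rewrite -sfun_act /= dcomp_dcst. Qed.

Definition map_of (X Z : sset) (a : smapping X Z 0) : smap X Z := SMap (map_of_subproof a).

Lemma vertex_ofK (X Z : sset) (f : smap X Z) : map_of (vertex_of f) = f.
Proof. exact: smap_ext. Qed.

Lemma map_ofK (X Z : sset) (a : smapping X Z 0) : vertex_of (map_of a) = a.
Proof. by apply: smap_ext => n [x t] /=; rewrite (dhom0 t (dcst n ord0)). Qed.

Lemma dcomp_dvertex n p (j : 'I_p.+1) (t : dhom n 0) : dcomp (dvertex j) t = dcst n j.
Proof. by apply: dhom_ext => i; rewrite dcompE !mk_dhomE. Qed.

Lemma edge_homotopic (X Z : sset) (a b : smapping X Z 0) :
  edge a b -> homotopic (map_of a) (map_of b).
Proof.
by case=> e [<- <-]; exists e; split; apply: smap_ext => n x /=; rewrite dcomp_dvertex.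
Qed.

Lemma homotopic_edge (X Z : sset) (f g : smap X Z) :
  homotopic f g -> edge (vertex_of f) (vertex_of g).
Proof.
by case=> H [<- <-]; exists H; split; apply: smap_ext => n [x t] /=; rewrite dcomp_dvertex.
Qed.

Lemma same_comp_homotopic (X Z : sset) (a b : smapping X Z 0) : Kan_complex Z ->
  same_comp a b -> homotopic (map_of a) (map_of b).
Proof.
move=> KZ; elim=> {a b} [a b|a|a b _|a b c _ ab _].
- exact: edge_homotopic.
- exact: homotopic_refl.
- exact: homotopic_sym.
- exact: homotopic_trans.
Qed.

Lemma same_comp_map (X Y : sset) (f : smap X Y) (x y : X 0) :
  same_comp x y -> same_comp (f 0 x) (f 0 y).
Proof.
elim=> {x y} [x y [e [ex ey]]|x|x y _|x y z _ xy _].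
- by apply: same_comp_edge; exists (f 1 e); rewrite -!sfun_act ex ey.
- exact: same_comp_refl.
- exact: same_comp_sym.
- exact: same_comp_trans.
Qed.

(** * Kan equivalences *)

Lemma smapping_pre_comp (X Y Z T : sset) (f : smap X Y) (g : smap Y Z) n (h : smapping Z T n) :
  smapping_pre (smap_comp g f) T n h = smapping_pre f T n (smapping_pre g T n h).
Proof. exact: smap_ext. Qed.

Lemma Kan_equivalence_comp (X Y Z : sset) (f : smap X Y) (g : smap Y Z) :
  Kan_equivalence f -> Kan_equivalence g -> Kan_equivalence (smap_comp g f).
Proof.
move=> ef eg T KT; have [fi fs] := ef T KT; have [gi gs] := eg T KT; split.
  by move=> a b; rewrite !smapping_pre_comp => /fi/gi.
move=> c; have [b bc] := fs c; have [a ab] := gs b; exists a.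
by rewrite smapping_pre_comp; apply: same_comp_trans bc; exact: same_comp_map.
Qed.

(** The two-out-of-three property is that of bijections on [pi_0]. *)
Lemma Kan_equivalence_cancel_post (X Y Z : sset) (f : smap X Y) (g : smap Y Z) :
  Kan_equivalence g -> Kan_equivalence (smap_comp g f) -> Kan_equivalence f.
Proof.
move=> eg egf T KT; have [gi gs] := eg T KT; have [gfi gfs] := egf T KT; split.
  move=> a b fab; have [a' a'a] := gs a; have [b' b'b] := gs b.
  apply: same_comp_trans (same_comp_sym a'a) _; apply: (same_comp_trans _ b'b).
  apply/(same_comp_map (smapping_pre g T))/gfi; rewrite !smapping_pre_comp.
  apply: same_comp_trans (same_comp_map (smapping_pre f T) a'a) _.
  apply: same_comp_trans fab _.
  exact/(same_comp_map (smapping_pre f T))/same_comp_sym.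
move=> c; have [a ac] := gfs c; exists (smapping_pre g T 0 a).
by rewrite -smapping_pre_comp.
Qed.

Lemma Kan_equivalence_cancel_pre (X Y Z : sset) (f : smap X Y) (g : smap Y Z) :
  Kan_equivalence f -> Kan_equivalence (smap_comp g f) -> Kan_equivalence g.
Proof.
move=> ef egf T KT; have [fi fs] := ef T KT; have [gfi gfs] := egf T KT; split.
  move=> a b /(same_comp_map (smapping_pre f T)); rewrite -!smapping_pre_comp; exact: gfi.
move=> b; have [a] := gfs (smapping_pre f T 0 b); rewrite smapping_pre_comp => /fi ab.
by exists a.
Qed.

(** Being defined by maps over [Y], this is visibly stable under pullback, unlike
    being a Kan equivalence; for Kan fibrations between Kan complexes the two
    notions agree. *)
Definition shrinkable (X Y : sset) (f : smap X Y) :=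
  exists (s : smap Y X) (H : smap (sprod X (simplex 1)) X),
    [/\ smap_comp f s = smap_id Y, at_end0 H = smap_comp s f, at_end1 H = smap_id X
      & forall n x t, f n (H n (x, t)) = f n x].

Lemma homotopic_post (X Y Z : sset) (g : smap Y Z) (a b : smap X Y) :
  homotopic a b -> homotopic (smap_comp g a) (smap_comp g b).
Proof. by case=> H [<- <-]; exists (smap_comp g H); split; exact: smap_ext. Qed.

Lemma homotopic_pre (X Y Z : sset) (f : smap X Y) (a b : smap Y Z) :
  homotopic a b -> homotopic (smap_comp a f) (smap_comp b f).
Proof.
case=> H [<- <-]; exists (smap_comp H (sprod_map f (smap_id _))).
by split; exact: smap_ext.
Qed.

Lemma shrinkable_Kan_equivalence (X Y : sset) (f : smap X Y) :
  shrinkable f -> Kan_equivalence f.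
Proof.
move=> [s [H [fs H0 H1 _]]] Z KZ; split.
  have fsE (a : smapping Y Z 0) : smapping_pre s Z 0 (smapping_pre f Z 0 a) = a.
    by rewrite -smapping_pre_comp fs; apply: smap_ext => n [].
  by move=> a b /(same_comp_map (smapping_pre s Z)); rewrite !fsE.
move=> b; exists (smapping_pre s Z 0 b); apply: same_comp_edge.
rewrite -smapping_pre_comp -[X in edge _ X]map_ofK.
have -> : smapping_pre (smap_comp s f) Z 0 b =
    vertex_of (smap_comp (map_of b) (smap_comp s f)).
  by rewrite -[LHS]map_ofK; congr vertex_of; exact: smap_ext.
apply: homotopic_edge; have -> : map_of b = smap_comp (map_of b) (smap_id X) by exact: smap_ext.
have -> : smap_comp (smap_comp (map_of b) (smap_id X)) (smap_comp s f) =
  smap_comp (map_of b) (smap_comp s f) by exact: smap_ext.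
by apply: homotopic_post; exists H.
Qed.

(** Dold's theorem. The universal property of [f] against the Kan complexes
    [X] and [Y] makes it a homotopy equivalence, whose inverse is deformed to
    an actual section [s] by lifting a homotopy. A homotopy [H] from [s f] to
    the identity lies over a loop at [f]; this loop is also the image of the
    homotopy [s f H], so that the two form a fork as in [homotopy_fork], whose
    filling is fibrewise constant. *)
Theorem Kan_equivalence_shrinkable (X Y : sset) (f : smap X Y) :
  Kan_complex X -> Kan_complex Y -> Kan_fibration f -> Kan_equivalence f -> shrinkable f.
Proof.
move=> KX KY Kf ef.
have [_ /(_ (vertex_of (smap_id X)))[s0 s0f]] := ef X KX.
pose s1 := map_of s0.
have s1f : homotopic (smap_comp s1 f) (smap_id X).
  have := same_comp_homotopic KX s0f; rewrite vertex_ofK.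
  by congr (homotopic _ _); exact: smap_ext.
have fs1 : homotopic (smap_comp f s1) (smap_id Y).
  have [inj _] := ef Y KY.
  rewrite -[smap_comp f s1]vertex_ofK -[smap_id Y]vertex_ofK.
  apply: (same_comp_homotopic KY); apply: inj; apply: same_comp_edge.
  have -> : smapping_pre f Y 0 (vertex_of (smap_comp f s1)) =
    vertex_of (smap_comp f (smap_comp s1 f)) by exact: smap_ext.
  have -> : smapping_pre f Y 0 (vertex_of (smap_id Y)) =
    vertex_of (smap_comp f (smap_id X)) by exact: smap_ext.
  exact/homotopic_edge/homotopic_post.
have [K [K0 K1]] := fs1.
pose h : smap (sprod sempty (simplex 1)) X :=
  @SMap (sprod sempty (simplex 1)) X (fun n z => match z.1 with end)
    (fun _ _ _ z => match z.1 with end).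
have [n []|n y|n []|K' [K'0 _ fK']] :=
  mono_homotopy_ext Kf (@of_sempty_mono Y) (u := s1) (h := h) (v := K).
  by have /= <- := smapE K0 y.
pose s := at_end1 K'.
have fs : smap_comp f s = smap_id Y.
  by rewrite -K1; apply: smap_ext => n y /=; rewrite fK'.
have s1s : homotopic s1 s by exists K'; split=> //; apply: smap_ext => n y /=.
have [H [H0 H1]] : homotopic (smap_comp s f) (smap_id X).
  by apply: (homotopic_fork KX _ s1f); exact: homotopic_pre.
pose al := smap_comp (smap_comp s f) H.
have fsE n y : f n (s n y) = y := smapE fs y.
have [||ga [ga0 ga1 fga]] := homotopy_fork (al := al) (be := H) Kf.
- by apply: smap_ext => n x; have /= := smapE H0 x => ->; rewrite fsE.
- by apply: smap_ext => n x /=; rewrite fsE.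
exists s, ga; split=> //.
- by rewrite ga0; apply: smap_ext => n x /=; have /= -> := smapE H1 x.
- by rewrite ga1.
- by move=> n x t; rewrite fga /= fsE; have /= -> := smapE H1 x.
Qed.

(** * Transfer along isomorphisms *)

Definition sbij (X Y : sset) (f : smap X Y) := forall n, bijective (f n).

Lemma sbij_inv (X Y : sset) (f : smap X Y) : sbij f ->
  exists g : smap Y X, (forall n, cancel (f n) (g n)) /\ (forall n, cancel (g n) (f n)).
Proof.
move=> fb; have inv n : {g | cancel (f n) g & cancel g (f n)}.
  by apply: cid2; case: (fb n) => g fg gf; exists g.
pose g n := s2val (inv n).
have fg n : cancel (f n) (g n) := s2valP (inv n).
have gf n : cancel (g n) (f n) := s2valP' (inv n).
have gact m n (a : dhom m n) y : g m (act a y) = act a (g n y).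
  by rewrite -{1}[y]gf -sfun_act fg.
by exists (SMap gact).
Qed.

Lemma sbij_shrinkable (X Y : sset) (f : smap X Y) : sbij f -> shrinkable f.
Proof.
move=> /sbij_inv[g [fg gf]]; exists g, (sfst X (simplex 1)); split=> //.
- by apply: smap_ext => n y /=; rewrite gf.
- by apply: smap_ext => n x /=; rewrite fg.
- exact: smap_ext.
Qed.

Section Iso.
Variables (X Y X' Y' : sset) (f : smap X Y) (f' : smap X' Y').
Variables (al : smap X X') (be : smap Y Y').
Hypotheses (al_bij : sbij al) (be_bij : sbij be).
Hypothesis comm : forall n x, be n (f n x) = f' n (al n x).

Lemma Kan_fibration_iso : Kan_fibration f' <-> Kan_fibration f.
Proof.
have [ga [alK gaK]] := sbij_inv al_bij; have [de [beK deK]] := sbij_inv be_bij.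
split=> Kf n i; apply/has_liftingP => u v uv.
  have [|w [wu wv]] := (has_liftingP _ _).1 (Kf n i) (smap_comp al u) (smap_comp be v).
    by move=> k x /=; rewrite -comm uv.
  exists (smap_comp ga w); split=> k x /=; first by rewrite wu alK.
  by apply: (can_inj (beK k)); rewrite comm gaK wv.
have [|w [wu wv]] := (has_liftingP _ _).1 (Kf n i) (smap_comp ga u) (smap_comp de v).
  by move=> k x /=; apply: (can_inj (beK k)); rewrite comm gaK uv deK.
exists (smap_comp al w); split=> k x /=; first by rewrite wu gaK.
by rewrite -comm wv deK.
Qed.

Lemma Kan_equivalence_iso : Kan_equivalence f' <-> Kan_equivalence f.
Proof.
have eal := shrinkable_Kan_equivalence (sbij_shrinkable al_bij).
have ebe := shrinkable_Kan_equivalence (sbij_shrinkable be_bij).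
have E : smap_comp be f = smap_comp f' al by exact: smap_ext.
split=> ef.
  by apply: Kan_equivalence_cancel_post ebe _; rewrite E; exact: Kan_equivalence_comp.
by apply: Kan_equivalence_cancel_pre eal _; rewrite -E; exact: Kan_equivalence_comp.
Qed.

End Iso.

(** * Mapping spaces out of discrete simplicial spaces *)

Definition row (W : sspace) (l : nat) : sset :=
  @SSet (fun k => W k l) (fun m n a x => sact W a l x)
        (fun n x => @sact_id W n l x) (fun m n p a b x => @sact_comp W m n p a b l x).

Definition row_act (W : sspace) m n (c : dhom m n) : smap (row W n) (row W m) :=
  @SMap (row W n) (row W m) (fun k x => act c x)
        (fun k l a x => esym (sfun_act (sact W a) c x)).

Lemma maps_id (B : sset) (W : sspace) n (h : smap B (row W n)) :
  smap_comp (row_act W (did n)) h = h.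
Proof. by apply: smap_ext => k b; rewrite /= act_id. Qed.

Lemma maps_comp (B : sset) (W : sspace) m n p (a : dhom n p) (b : dhom m n)
  (h : smap B (row W p)) :
  smap_comp (row_act W (dcomp a b)) h = smap_comp (row_act W b) (smap_comp (row_act W a) h).
Proof. by apply: smap_ext => k x; rewrite /= act_comp. Qed.

(** By the Yoneda lemma in the direction of the spaces, this is [Map] out of the
    discrete simplicial space on [B], see [Map_maps] below. *)
Definition maps (B : sset) (W : sspace) : sset :=
  @SSet (fun l => smap B (row W l)) (fun m n c h => smap_comp (row_act W c) h)
        (@maps_id B W) (@maps_comp B W).

Lemma maps_pre_subproof (A B : sset) (i : smap A B) (W : sspace) m n (c : dhom m n)
  (h : maps B W n) :
  smap_comp (act c h : smap _ _) i = act (s := maps A W) c (smap_comp (h : smap _ _) i).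
Proof. exact: smap_ext. Qed.

Definition maps_pre (A B : sset) (i : smap A B) (W : sspace) :
    smap (maps B W) (maps A W) :=
  @SMap (maps B W) (maps A W) (fun l h => smap_comp (h : smap _ _) i)
        (@maps_pre_subproof A B i W).

Section MapMaps.
Variables (B : sset) (W : sspace).

Lemma Map_maps_at_subproof l (h : Map (disc_ss B) W l) k n (a : dhom k n) (b : B n) :
  (h : ssmap _ _) k l (act a b, did l) = act (s := row W l) a ((h : ssmap _ _) n l (b, did l)).
Proof. exact: (@ssfun_act _ _ (h : ssmap _ _) k n a l (b, did l)). Qed.

Definition Map_maps_at l (h : Map (disc_ss B) W l) : maps B W l :=
  @SMap B (row W l) (fun k b => (h : ssmap _ _) k l (b, did l)) (Map_maps_at_subproof h).

Lemma Map_maps_subproof m n (c : dhom m n) (h : Map (disc_ss B) W n) :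
  Map_maps_at (act c h) = act c (Map_maps_at h).
Proof.
apply: smap_ext => k b; rewrite /= -(sfun_act ((h : ssmap _ _) k)) /=.
by rewrite dcomp_idr dcomp_idl.
Qed.

Definition Map_maps : smap (Map (disc_ss B) W) (maps B W) := SMap Map_maps_subproof.

Lemma Map_maps_bij : sbij Map_maps.
Proof.
move=> l.
have gact (h : maps B W l) k m n (a : dhom m n)
    (x : ssprod (disc_ss B) (const_ss (simplex l)) k n) :
    act (act a x : B k * dhom m l).2 ((h : smap _ _) k (act a x).1) =
    act a (act (x.2 : dhom n l) ((h : smap _ _) k x.1)).
  by rewrite /= act_comp.
pose g1 h k : smap (ssprod (disc_ss B) (const_ss (simplex l)) k) (W k) := SMap (gact h k).
have gsact h m n (a : dhom m n) k (x : ssprod (disc_ss B) (const_ss (simplex l)) n k) :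
    g1 h m k (sact _ a k x) = sact W a k (g1 h n k x).
  rewrite /= (sfun_act (h : smap _ _)) /=.
  exact: esym (sfun_act (sact W a) _ _).
pose g h : Map (disc_ss B) W l := SSMap (gsact h).
exists g => h.
  apply: ssmap_ext => k n [b x] /=.
  by rewrite -(sfun_act ((h : ssmap _ _) k)) /= dcomp_idl.
by apply: smap_ext => k b /=; rewrite act_id.
Qed.

End MapMaps.

Lemma Map_maps_nat (A B : sset) (i : smap A B) (W : sspace) l (h : Map (disc_ss B) W l) :
  Map_maps A W l (Map_pre (disc_ss_map i) W l h) = maps_pre i W l (Map_maps B W l h).
Proof. exact: smap_ext. Qed.

Lemma Map_Kan_fibration (A B : sset) (i : smap A B) (W : sspace) :
  Kan_fibration (maps_pre i W) <-> Kan_fibration (Map_pre (disc_ss_map i) W).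
Proof. exact: Kan_fibration_iso (Map_maps_bij B W) (Map_maps_bij A W) (@Map_maps_nat A B i W). Qed.

Lemma Map_Kan_equivalence (A B : sset) (i : smap A B) (W : sspace) :
  Kan_equivalence (maps_pre i W) <-> Kan_equivalence (Map_pre (disc_ss_map i) W).
Proof.
exact: Kan_equivalence_iso (Map_maps_bij B W) (Map_maps_bij A W) (@Map_maps_nat A B i W).
Qed.

(** * Exchanging the two simplicial directions *)

Lemma power_id (L : sset) (W : sspace) n (h : smap L (W n)) :
  smap_comp (sact W (did n)) h = h.
Proof. by apply: smap_ext => l x; rewrite /= sact_id. Qed.

Lemma power_comp (L : sset) (W : sspace) m n p (a : dhom n p) (b : dhom m n)
  (h : smap L (W p)) :
  smap_comp (sact W (dcomp a b)) h = smap_comp (sact W b) (smap_comp (sact W a) h).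
Proof. by apply: smap_ext => l x; rewrite /= sact_comp. Qed.

Definition power (L : sset) (W : sspace) : sset :=
  @SSet (fun k => smap L (W k)) (fun m n a h => smap_comp (sact W a) h)
        (@power_id L W) (@power_comp L W).

Lemma power_pre_subproof (K L : sset) (j : smap K L) (W : sspace) m n (a : dhom m n)
  (h : power L W n) :
  smap_comp (act a h : smap _ _) j = act (s := power K W) a (smap_comp (h : smap _ _) j).
Proof. exact: smap_ext. Qed.

Definition power_pre (K L : sset) (j : smap K L) (W : sspace) :
    smap (power L W) (power K W) :=
  @SMap (power L W) (power K W) (fun k h => smap_comp (h : smap _ _) j)
        (@power_pre_subproof K L j W).

Section Flip.
Variables (B L : sset) (W : sspace).

Lemma flip_at_subproof (f : smap L (maps B W)) k (b : B k) m n (c : dhom m n) (x : L n) :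
  (f m (act c x) : smap _ _) k b = act c ((f n x : smap _ _) k b).
Proof. by rewrite sfun_act. Qed.

Definition flip_at (f : smap L (maps B W)) k (b : B k) : power L W k :=
  SMap (flip_at_subproof f b).

Lemma flip_subproof (f : smap L (maps B W)) m n (a : dhom m n) (b : B n) :
  flip_at f (act a b) = act a (flip_at f b).
Proof. by apply: smap_ext => l x /=; rewrite (sfun_act (f l x : smap _ _)). Qed.

Definition flip (f : smap L (maps B W)) : smap B (power L W) := SMap (flip_subproof f).

Lemma unflip_at_subproof (g : smap B (power L W)) l (x : L l) m n (a : dhom m n) (b : B n) :
  (g m (act a b) : smap _ _) l x = act (s := row W l) a ((g n b : smap _ _) l x).
Proof. by rewrite sfun_act. Qed.

Definition unflip_at (g : smap B (power L W)) l (x : L l) : maps B W l :=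
  @SMap B (row W l) (fun k b => (g k b : smap _ _) l x) (unflip_at_subproof g x).

Lemma unflip_subproof (g : smap B (power L W)) m n (c : dhom m n) (x : L n) :
  unflip_at g (act c x) = act c (unflip_at g x).
Proof. by apply: smap_ext => k b /=; rewrite (sfun_act (g k b : smap _ _)). Qed.

Definition unflip (g : smap B (power L W)) : smap L (maps B W) := SMap (unflip_subproof g).

End Flip.

(** Both sides express the extension, from [A x L] and [B x K] to [B x L], of maps
    to the bisimplicial set [W]. *)
Lemma maps_pre_lifting (A B K L : sset) (i : smap A B) (j : smap K L) (W : sspace) :
  has_lifting i (power_pre j W) <-> has_lifting j (maps_pre i W).
Proof.
split=> /has_liftingP li; apply/has_liftingP => u v uv.
  have [k a|w [wu wv]] := li (flip v) (flip u).
    by apply: smap_ext => l x /=; exact: (esym (smapE (uv l x) a)).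
  exists (unflip w); split=> l x; apply: smap_ext => k b /=.
    exact: (smapE (wv k b) x).
  exact: (smapE (wu k b) x).
have [k a|w [wu wv]] := li (unflip v) (unflip u).
  by apply: smap_ext => l x /=; exact: (esym (smapE (uv l x) a)).
exists (flip w); split=> l x; apply: smap_ext => k b /=.
  exact: (smapE (wv k b) x).
exact: (smapE (wu k b) x).
Qed.

(** * Consequences of Reedy fibrancy *)

Section Reedy.
Variables (W : sspace) (RW : Reedy_fibrant W).

(** Reedy fibrancy concerns the boundary inclusions only; after exchanging the two
    directions, [mono_lifting] extends it to all the monomorphisms. *)
Lemma Reedy_mono (A B : sset) (i : smap A B) : smono i -> Kan_fibration (maps_pre i W).
Proof.
move=> iI n j; apply/maps_pre_lifting/mono_lifting => // m.
by apply/maps_pre_lifting; exact: ((Map_Kan_fibration (ssub_incl (@bdry_closed m)) W).2 (@RW m) n j).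
Qed.

(** The point is the mapping space out of the empty simplicial set. *)
Lemma Reedy_Kan_complex (B : sset) : Kan_complex (maps B W).
Proof.
move=> n j; apply/has_liftingP => u v _.
have vact m k (a : dhom m k) (x : simplex n.+1 k) :
    of_sempty (row W m) = act (s := maps sempty W) a (of_sempty (row W k)).
  by apply: smap_ext => l [].
pose v' : smap (simplex n.+1) (maps sempty W) :=
  @SMap (simplex n.+1) (maps sempty W) (fun m _ => of_sempty (row W m)) vact.
have [k x|w [wu _]] := (has_liftingP _ _).1 (@Reedy_mono _ _ _ (@of_sempty_mono B) n j) u v'.
  by apply: smap_ext => l [].
by exists w; split=> // k y; case: (v k y).
Qed.

End Reedy.

(** A pushout induces a pullback of mapping spaces, along which the section and
    the fibrewise deformation are transported; gluing is functorial because it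
    is unique. *)
Lemma pushout_shrinkable (A B A' B' : sset) (i : smap A B) (t : smap A A')
    (s : smap B B') (i' : smap A' B') (W : sspace) : pushout i t s i' ->
  shrinkable (maps_pre i W) -> shrinkable (maps_pre i' W).
Proof.
move=> po [sec [H [isec H0 H1 iH]]].
have glue l (f : smap A' (row W l)) (g : smap B (row W l)) : smap_comp f t = smap_comp g i ->
    {h : smap B' (row W l) | smap_comp h i' = f /\ smap_comp h s = g}.
  move=> fg; apply: cid; have [n a|h [hf hg]] := pushout_glue po (f := f) (g := g).
    exact: (smapE fg a).
  by exists h; split; exact: smap_ext.
have joint l (h h' : smap B' (row W l)) :
    smap_comp h i' = smap_comp h' i' -> smap_comp h s = smap_comp h' s -> h = h'.
  move=> hi hs; apply: smap_ext => n; apply: (pushout_joint po) => x.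
    exact: (smapE hi).
  exact: (smapE hs).
have sec_ok l (f : maps A' W l) :
    smap_comp f t = smap_comp (sec l (maps_pre t W l f)) i.
  exact: esym (smapE isec (maps_pre t W l f)).
pose sec' l (f : maps A' W l) : maps B' W l := sval (glue l f _ (sec_ok l f)).
have sec'i l f : smap_comp (sec' l f) i' = f := (svalP (glue l f _ (sec_ok l f))).1.
have sec's l f : smap_comp (sec' l f) s = sec l (maps_pre t W l f) :=
  (svalP (glue l f _ (sec_ok l f))).2.
have sec'act m n (a : dhom m n) (f : maps A' W n) : sec' m (act a f) = act a (sec' n f).
  apply: joint.
    by rewrite sec'i -[in LHS](sec'i n f); exact: smap_ext.
  have -> : smap_comp (act a (sec' n f) : smap _ _) s =
    act (s := maps B W) a (smap_comp (sec' n f) s) by exact: smap_ext.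
  by rewrite !sec's -sfun_act; congr (sec m _); exact: smap_ext.
have H_ok l (x : sprod (maps B' W) (simplex 1) l) :
    smap_comp (maps_pre i' W l x.1) t = smap_comp (H l (maps_pre s W l x.1, x.2)) i.
  have := iH l (maps_pre s W l x.1) x.2; rewrite /= => ->.
  by apply: smap_ext => n a /=; rewrite (po_comm po).
pose H' l (x : sprod (maps B' W) (simplex 1) l) : maps B' W l := sval (glue l _ _ (H_ok l x)).
have H'i l x : smap_comp (H' l x) i' = smap_comp (x.1 : smap _ _) i' :=
  (svalP (glue l _ _ (H_ok l x))).1.
have H's l x : smap_comp (H' l x) s = H l (maps_pre s W l x.1, x.2) :=
  (svalP (glue l _ _ (H_ok l x))).2.
have H'act m n (a : dhom m n) x : H' m (act a x) = act a (H' n x).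
  apply: joint.
    rewrite H'i.
    have -> : smap_comp (act a (H' n x) : smap _ _) i' =
      act (s := maps A' W) a (smap_comp (H' n x) i') by exact: smap_ext.
    by rewrite H'i; exact: smap_ext.
  have -> : smap_comp (act a (H' n x) : smap _ _) s =
    act (s := maps B W) a (smap_comp (H' n x) s) by exact: smap_ext.
  rewrite !H's -sfun_act; congr (H m _); congr (_, _); exact: smap_ext.
exists (SMap sec'act), (SMap H'act); split.
- by apply: smap_ext => n f; exact: sec'i.
- apply: smap_ext => n f; apply: joint => /=; first by rewrite H'i sec'i.
  rewrite H's sec's; have /= -> := smapE H0 (maps_pre s W n f).
  by congr (sec n _); apply: smap_ext => k a /=; rewrite (po_comm po).
- apply: smap_ext => n f; apply: joint => /=; first by rewrite H'i.
  by rewrite H's; exact: (smapE H1 (maps_pre s W n f)).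
- by move=> n f t'; exact: H'i.
Qed.

(** * The functor [Q] on subcomplexes of simplices *)

(** The map of sets [[n]^op * [n] -> [n]] forgetting the side of the join. *)
Definition Qfold n (v : 'I_(n.+1 + n.+1)) : 'I_n.+1 :=
  match split v with inl k => rev_ord k | inr k => k end.

Lemma Qfold_lshift n (k : 'I_n.+1) : Qfold (lshift n.+1 k) = rev_ord k.
Proof. by rewrite /Qfold (unsplitK (inl _)). Qed.

Lemma Qfold_rshift n (k : 'I_n.+1) : Qfold (rshift n.+1 k) = k.
Proof. by rewrite /Qfold (unsplitK (inr _)). Qed.

Lemma fmapQ_lshift m n (s : dhom m n) (k : 'I_m.+1) :
  fmap Q s (lshift m.+1 k) = lshift n.+1 (rev_ord (s (rev_ord k))) :> 'I_(n.+1 + n.+1).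
Proof. by rewrite -dopE -(join_fun_lshift _ s); exact: join_funE. Qed.

Lemma fmapQ_rshift m n (s : dhom m n) (k : 'I_m.+1) :
  fmap Q s (rshift m.+1 k) = rshift n.+1 (s k) :> 'I_(n.+1 + n.+1).
Proof. by rewrite -(join_fun_rshift (dop s)); exact: join_funE. Qed.

Lemma Qfold_fmap m n (s : dhom m n) (w : 'I_(m.+1 + m.+1)) :
  Qfold (fmap Q s w : 'I_(n.+1 + n.+1)) = s (Qfold w).
Proof.
case: (split_ordP w) => k ->.
  by rewrite fmapQ_lshift !Qfold_lshift rev_ordK.
by rewrite fmapQ_rshift !Qfold_rshift.
Qed.

Lemma fmapQ_codom m n (s : dhom m n) (v : 'I_(n.+1 + n.+1)) i :
  s i = Qfold v -> exists w, fmap Q s w = v.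
Proof.
case: (split_ordP v) => k ->; rewrite ?Qfold_lshift ?Qfold_rshift => si.
  exists (lshift m.+1 (rev_ord i)).
  by have := fmapQ_lshift s (rev_ord i); rewrite rev_ordK si rev_ordK.
by exists (rshift m.+1 i); have := fmapQ_rshift s i; rewrite si.
Qed.

Lemma fmapQ_inj m n (s : dhom m n) : injective s -> injective (fmap Q s).
Proof.
move=> sI; suff H (w w' : 'I_(m.+1 + m.+1)) :
  fmap Q s w = fmap Q s w' :> 'I_(n.+1 + n.+1) -> w = w' by exact: H.
case: (split_ordP w) => k ->; case: (split_ordP w') => k' ->;
  rewrite ?fmapQ_lshift ?fmapQ_rshift.
- by move/lshift_inj/rev_ord_inj/sI/rev_ord_inj ->.
- by move/eqP; rewrite eq_lrshift.
- by move/eqP; rewrite eq_rlshift.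
- by move/rshift_inj/sI ->.
Qed.

Definition Q_natural (P Y : sset) (u : forall k, P k -> Y (Q k)) :=
  forall m n (a : dhom m n) x, u m (act a x) = act (fmap Q a) (u n x).

(** Left Kan extension along [Q]: the maps [P' -> Y] correspond to the maps
    from [P] to the restriction of [Y] along [Q]. *)
Record Q_extension (P P' : sset) (ka : forall k, P k -> P' (Q k)) : Prop := {
  Q_ext_nat : Q_natural ka;
  Q_ext_gen : forall k (z : P' k), exists m (d : P m) (y : dhom k (Q m)), z = act y (ka m d);
  Q_ext_ex : forall (Y : sset) (u : forall k, P k -> Y (Q k)), Q_natural u ->
    exists v : smap P' Y, forall k d, v (Q k) (ka k d) = u k d }.

Lemma Q_extension_simplex n :
  @Q_extension (simplex n) (simplex (Q n)) (fun k d => fmap Q (d : dhom k n)).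
Proof.
split.
- by move=> k l a x; exact: (fmap_comp Q x a).
- by move=> k z; exists n, (did n), z; rewrite fmap_id; exact: esym (dcomp_idl z).
- move=> Y u un.
  have vact k l (a : dhom k l) (z : simplex (Q n) l) :
      act (act a z : dhom _ _) (u n (did n)) = act a (act (z : dhom _ _) (u n (did n))).
    by rewrite /= act_comp.
  by exists (SMap vact) => k d; rewrite -[d in RHS]dcomp_idl; exact: esym (un _ _ d _).
Qed.

Section QImage.
Variables (n : nat) (P : forall k, pred (simplex n k)) (HP : sub_closed P).

Definition Qimg_pred k : pred (simplex (Q n) k) := fun x =>
  `[< exists m (d : dhom m n) (y : dhom k (Q m)), P (d : simplex n m) /\ x = dcomp (fmap Q d) y >].

Lemma Qimg_closed : sub_closed Qimg_pred.
Proof.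
move=> k l a x /asboolP[m [d [y [dP ->]]]]; apply/asboolP.
by exists m, d, (dcomp y a); rewrite /= dcompA.
Qed.

Lemma Qimg_unit_subproof k (d : ssub HP k) :
  Qimg_pred (fmap Q (sval d : dhom k n) : simplex (Q n) (Q k)).
Proof.
apply/asboolP; exists k, (sval d), (did (Q k)); split; first exact: (svalP d).
by rewrite dcomp_idr.
Qed.

Definition Qimg_unit k (d : ssub HP k) : ssub Qimg_closed (Q k) :=
  exist _ (fmap Q (sval d : dhom k n) : simplex (Q n) (Q k)) (Qimg_unit_subproof d).

(** A simplex [x] of [Qimg_pred] is [Q(d) y] with [d] an injection in [P].
    Two such presentations agree because they both restrict to the
    intersection of the two faces: [Q] preserves intersections of faces. *)
Lemma Q_extension_sub : Q_extension Qimg_unit.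
Proof.
have unat : Q_natural Qimg_unit.
  move=> k l a x; apply: (@ssub_ext _ _ Qimg_closed); exact: fmap_comp.
split=> //.
  move=> k [x xP]; have [m [d [y [dP xE]]]] := asboolP _ xP.
  by exists m, (exist _ (d : simplex n m) dP), y; apply: (@ssub_ext _ _ Qimg_closed).
move=> Y u un.
pose R k (x : ssub Qimg_closed k) (e : Y k) :=
  exists m (d : ssub HP m) (y : dhom k (Q m)),
    [/\ injective (sval d : dhom m n), sval x = dcomp (fmap Q (sval d : dhom m n)) y
      & e = act y (u m d)].
have [|k x e e'|k l a x e|v vR] := @smap_of_graph (ssub Qimg_closed) Y R.
- move=> k [x xP]; have [m [d [y [dP xE]]]] := asboolP _ xP.
  have [l [s [t [dE sI tS _]]]] := dhom_epi_mono d.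
  have [r tr _] := dhom_section ord0 tS.
  have sP : P (s : simplex n l).
    by rewrite -[s]dcomp_idr -tr dcompA -dE; exact: (HP r dP).
  exists (act (dcomp (fmap Q t) y) (u l (exist _ (s : simplex n l) sP))).
  exists l, (exist _ (s : simplex n l) sP), (dcomp (fmap Q t) y); split=> //=.
  by rewrite xE dE fmap_comp dcompA.
- case=> m [d [y [dI xE ->]]] [m' [d' [y' [dI' xE' ->]]]].
  pose fx i := Qfold ((sval x : dhom k (Q n)) i : 'I_(n.+1 + n.+1)).
  have fold_d i : fx i \in codom (sval d : dhom m n).
    by rewrite /fx xE dcompE Qfold_fmap codom_f.
  have fold_d' i : fx i \in codom (sval d' : dhom m' n).
    by rewrite /fx xE' dcompE Qfold_fmap codom_f.
  pose S := [set i | (i \in codom (sval d : dhom m n)) && (i \in codom (sval d' : dhom m' n))].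
  have [|l [r [_ rI rS]]] := @dhom_of_set n S (fx ord0).
    by rewrite inE fold_d fold_d'.
  have [i|z rz] := dhom_factor (x := r) dI.
    have : r i \in S by rewrite -rS codom_f.
    by rewrite inE => /andP[/codomP[j ->] _]; exists j.
  have [i|z' rz'] := dhom_factor (x := r) dI'.
    have : r i \in S by rewrite -rS codom_f.
    by rewrite inE => /andP[_ /codomP[j ->]]; exists j.
  have [i|w xw] := dhom_factor (x := sval x : dhom k (Q n)) (fmapQ_inj rI).
    have : fx i \in codom r.
      by rewrite rS inE fold_d fold_d'.
    by move=> /codomP[j /esym]; exact: fmapQ_codom.
  have yE : y = dcomp (fmap Q z) w.
    apply: (dcomp_injl (fmapQ_inj dI)); rewrite -xE xw rz fmap_comp.
    exact/esym/dcompA.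
  have yE' : y' = dcomp (fmap Q z') w.
    apply: (dcomp_injl (fmapQ_inj dI')); rewrite -xE' xw rz' fmap_comp.
    exact/esym/dcompA.
  rewrite yE yE' !act_comp -!un; congr (act w (u l _)).
  by apply: ssub_ext; rewrite /= -rz -rz'.
- case=> m [d [y [dI xE ->]]]; exists m, d, (dcomp y a); split=> //.
    by rewrite /= xE dcompA.
  by rewrite act_comp.
exists v => k d.
have [m [d' [y [dI' dE ->]]]] := vR (Q k) (Qimg_unit d).
have [l [s [t [sE sI tS _]]]] := dhom_epi_mono (sval d : dhom k n).
have [r tr _] := dhom_section ord0 tS.
have [i|z rz] := dhom_factor (x := sval d : dhom k n) dI'.
  have := Qfold_fmap (sval d : dhom k n) (rshift k.+1 i).
  have -> : fmap Q (sval d : dhom k n) = dcomp (fmap Q (sval d' : dhom m n)) y by exact: dE.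
  rewrite dcompE Qfold_fmap Qfold_rshift => <-.
  by exists (Qfold (y (rshift k.+1 i) : 'I_(m.+1 + m.+1))).
have -> : y = fmap Q z.
  apply: (dcomp_injl (fmapQ_inj dI')); rewrite -fmap_comp -rz.
  exact: (esym dE).
by rewrite -un; congr (u k _); apply: ssub_ext.
Qed.

End QImage.

(** * Mapping spaces into the twisted arrow construction *)

Section TwMaps.
Variables (P P' : sset) (ka : forall k, P k -> P' (Q k)) (ext : Q_extension ka).
Variable W : sspace.

Lemma Tw_maps_at_subproof l (h : maps P' W l) m n (a : dhom m n) (x : P n) :
  (h : smap _ _) (Q m) (ka (act a x)) = act (s := row (Tw W) l) a ((h : smap _ _) (Q n) (ka x)).
Proof. by rewrite (Q_ext_nat ext) sfun_act. Qed.

Definition Tw_maps_at l (h : maps P' W l) : maps P (Tw W) l :=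
  @SMap P (row (Tw W) l) (fun k x => (h : smap _ _) (Q k) (ka x)) (Tw_maps_at_subproof h).

Lemma Tw_maps_subproof m n (c : dhom m n) (h : maps P' W n) :
  Tw_maps_at (act c h) = act c (Tw_maps_at h).
Proof. exact: smap_ext. Qed.

Definition Tw_maps : smap (maps P' W) (maps P (Tw W)) := SMap Tw_maps_subproof.

Lemma Tw_maps_bij : sbij Tw_maps.
Proof.
move=> l.
have ex (u : maps P (Tw W) l) : {v : smap P' (row W l) |
    forall k d, v (Q k) (ka d) = (u : smap _ _) k d}.
  apply: cid; apply: (Q_ext_ex ext (Y := row W l) (u := fun k => (u : smap _ _) k)).
  by move=> m n a x; rewrite sfun_act.
have inj (v v' : maps P' W l) : Tw_maps l v = Tw_maps l v' -> v = v'.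
  move=> vv'; apply: smap_ext => k z; have [m [d [y ->]]] := Q_ext_gen ext z.
  by rewrite !sfun_act; congr act; exact: (smapE vv' d).
have surj u : Tw_maps l (sval (ex u)) = u.
  by apply: smap_ext => k d; exact: (svalP (ex u)).
exists (fun u => sval (ex u)) => // v.
exact: inj.
Qed.

End TwMaps.

Section TwPre.
Variables (A A' B B' : sset) (i : smap A B) (i' : smap A' B').
Variables (ka : forall k, A k -> A' (Q k)) (kb : forall k, B k -> B' (Q k)).
Hypotheses (exta : Q_extension ka) (extb : Q_extension kb).
Hypothesis comm : forall k x, i' (Q k) (ka x) = kb (i k x).
Variable W : sspace.

Let square l (h : maps B' W l) :
  Tw_maps exta W l (maps_pre i' W l h) = maps_pre i (Tw W) l (Tw_maps extb W l h).
Proof. by apply: smap_ext => k x; rewrite /= comm. Qed.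

Lemma Tw_Kan_fibration : Kan_fibration (maps_pre i' W) -> Kan_fibration (maps_pre i (Tw W)).
Proof. exact: (Kan_fibration_iso (Tw_maps_bij extb W) (Tw_maps_bij exta W) square).2. Qed.

Lemma Tw_Kan_equivalence : Kan_equivalence (maps_pre i' W) -> Kan_equivalence (maps_pre i (Tw W)).
Proof. exact: (Kan_equivalence_iso (Tw_maps_bij extb W) (Tw_maps_bij exta W) square).2. Qed.

End TwPre.

(** * The tetrahedra of the image of the spine *)

Section Spine.
Variable n : nat.

Lemma spine_edge_lt (i : 'I_n) (b : 'I_2) : i + b < n.+1.
Proof. by have := ltn_ord i; have := ltn_ord b; lia. Qed.

Lemma spine_edge_subproof (i : 'I_n) : monotone (fun b : 'I_2 => inord (i + b) : 'I_n.+1).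
Proof. by move=> b b' bb'; rewrite !inordK ?spine_edge_lt ?leq_add2l. Qed.

Definition spine_edge (i : 'I_n) : dhom 1 n := mk_dhom (@spine_edge_subproof i).

Lemma spine_edgeE i b : spine_edge i b = i + b :> nat.
Proof. by rewrite mk_dhomE inordK ?spine_edge_lt. Qed.

(** The tetrahedron with vertices [i+1, i] in [[n]^op] and [i, i+1] in [[n]]. *)
Definition tetra (i : 'I_n) : dhom 3 (Q n) := fmap Q (spine_edge i).

Lemma tetraE i (w : 'I_4) : tetra i w = (if w < 2 then n - i.+1 + w else (n + i + w).-1) :> nat.
Proof.
have H (v : 'I_(2 + 2)) : (fmap Q (spine_edge i) v : nat) =
    (if v < 2 then n - i.+1 + v else (n + i + v).-1).
  have := ltn_ord i; case: (split_ordP v) => k -> ltin; have := ltn_ord k.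
    have -> := congr1 (@nat_of_ord _) (fmapQ_lshift (spine_edge i) k).
    by rewrite /= spine_edgeE /=; case: ltnP; lia.
  have -> := congr1 (@nat_of_ord _) (fmapQ_rshift (spine_edge i) k).
  by rewrite /= spine_edgeE /=; lia.
exact: H.
Qed.

Lemma tetra_lt i (w w' : 'I_4) : w < w' -> tetra i w < tetra i w'.
Proof.
rewrite !tetraE => ww'; have := ltn_ord i; have := ltn_ord w'.
by case: (ltnP w 2); case: (ltnP w' 2); lia.
Qed.

Lemma tetra_inj i : injective (tetra i).
Proof.
move=> w w' /(congr1 (@nat_of_ord _)) ww'; apply: ord_inj.
by case: (ltngtP w w') => // /(tetra_lt i); rewrite ww' ltnn.
Qed.

Definition tetras_pred (j : nat) k : pred (simplex (Q n) k) := fun x =>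
  `[< G_pred x \/ exists (i : 'I_n) (y : dhom k 3), i < j /\ x = dcomp (tetra i) y >].

Lemma tetras_closed j : sub_closed (@tetras_pred j).
Proof.
move=> k l a x /asboolP[xG|[i [y [ij ->]]]]; apply/asboolP; first by left; exact: G_closed.
by right; exists i, (dcomp y a); rewrite /= dcompA.
Qed.


Lemma tetras0 k (x : simplex (Q n) k) : tetras_pred 0 x = G_pred x.
Proof. by apply/asboolP/idP => [[//|[i [y []]]]|]; [rewrite ltn0 | left]. Qed.

Lemma tetra_next (j : 'I_n) k (y : dhom k 3) : G_pred (y : simplex 3 k) ->
  tetras_pred j (dcomp (tetra j) y : simplex (Q n) k).
Proof.
move=> yG; apply/asboolP; have jn := ltn_ord j.
have mid l : y ord0 <= y l <= y ord_max by rewrite !(dmono y) ?leq_ord.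
case: (posnP j) => [j0|j0].
  left; move: yG; rewrite /G_pred !dcompE !tetraE j0.
  have := ltn_ord (y ord0); have := ltn_ord (y ord_max); move: (mid ord0).
  by case: (ltnP (y ord0) 2); case: (ltnP (y ord_max) 2); lia.
case: (eqVneq (y ord0 : nat) 1) => y0; last first.
  left; move: yG; rewrite /G_pred !dcompE !tetraE.
  have := ltn_ord (y ord0); have := ltn_ord (y ord_max); move: (mid ord0).
  by case: (ltnP (y ord0) 2); case: (ltnP (y ord_max) 2); lia.
(* The edge [1, 2] of the tetrahedron is the edge [0, 3] of the previous one. *)
right; have jn' : j.-1 < n by lia.
exists (Ordinal jn').
have [l|z ->] := dhom_factor (x := dcomp (tetra j) y) (@tetra_inj (Ordinal jn')); last first.
  by exists z; split=> //=; lia.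
rewrite dcompE; have := mid l; move: yG; rewrite /G_pred y0 => yG.
case: (eqVneq (y l : nat) 1) => yl /andP[_ yle].
  by exists ord0; apply: ord_inj; rewrite !tetraE yl /=; lia.
have {}yl : y l = 2 :> nat by have := mid l; lia.
by exists ord_max; apply: ord_inj; rewrite !tetraE yl /=; lia.
Qed.

(** Two distinct tetrahedra have at most the middle edge [1, 2] of the later one
    in common. *)
Lemma tetra_meet (j : 'I_n) k (y : dhom k 3) :
  tetras_pred j (dcomp (tetra j) y : simplex (Q n) k) -> G_pred (y : simplex 3 k).
Proof.
have jn := ltn_ord j.
case/asboolP => [|[i [z [ij tz]]]].
  rewrite /G_pred !dcompE => tG; rewrite leqNgt; apply/negP => y2.
  have y1 : (y ord0).+1 < 4 by have := ltn_ord (y ord_max); lia.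
  have t01 : tetra j (y ord0) < tetra j (Ordinal y1) by exact: tetra_lt.
  have t12 : tetra j (Ordinal y1) < tetra j (y ord_max) by apply: tetra_lt => /=; lia.
  lia.
have yl l : 0 < y l <= 2.
  have := congr1 (fun d : dhom k (Q n) => d l : nat) tz; rewrite !dcompE !tetraE.
  have := ltn_ord (y l); have := ltn_ord (z l); have := ltn_ord i.
  by case: (ltnP (y l) 2) => ?; case: (ltnP (z l) 2) => ?; lia.
by rewrite /G_pred; have := yl ord0; have := yl ord_max; lia.
Qed.

Lemma tetras_step j k (x : simplex (Q n) k) : tetras_pred j x -> tetras_pred j.+1 x.
Proof.
move=> /asboolP[xG|[i [y [ij xE]]]]; apply/asboolP; [by left | right].
by exists i, y; split=> //; exact: ltnW.
Qed.

Lemma tetras_cell (j : 'I_n) k (y : dhom k 3) :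
  tetras_pred j.+1 (dcomp (tetra j) y : simplex (Q n) k).
Proof. by apply/asboolP; right; exists j, y. Qed.

Lemma G_pred_between k p (x : dhom k p) l : G_pred (x : simplex p k) ->
  x ord0 <= x l <= (x ord0).+1.
Proof.
rewrite /G_pred leq_subLR addn1 => xG.
by rewrite (dmono x) //= (leq_trans _ xG) // (dmono x) // leq_ord.
Qed.

Lemma spine_edge_inj i : injective (spine_edge i).
Proof.
move=> b b' /(congr1 (@nat_of_ord _)); rewrite !spine_edgeE => /addnI; exact: ord_inj.
Qed.

Lemma G_pred_spine_edge m (d : dhom m n) : 0 < n -> G_pred (d : simplex n m) ->
  exists (i : 'I_n) (e : dhom m 1), d = dcomp (spine_edge i) e.
Proof.
move=> n0 dG; have i0n : minn (d ord0) n.-1 < n by lia.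
exists (Ordinal i0n); apply: (dhom_factor (@spine_edge_inj _)) => l.
have := G_pred_between l dG; have := ltn_ord (d l) => dln dl.
have e2 : d l - minn (d ord0) n.-1 < 2 by lia.
by exists (Ordinal e2); apply: ord_inj; rewrite spine_edgeE /=; lia.
Qed.

(** Chosen so that the vertex [v] of [[2n+1]] and the next one, if any, both
    belong to the tetrahedron of index [tetra_index v]. *)
Definition tetra_index (v : nat) := if v < n then n.-1 - v else minn (v - n.+1) n.-1.

Lemma tetra_index_lt v : 0 < n -> tetra_index v < n.
Proof. by rewrite /tetra_index; case: (ltnP v n); lia. Qed.

Lemma tetra_index_vertex v a : 0 < n -> v <= a <= v.+1 -> a < n + n.+2 ->
  exists2 w, w < 4 &
    a = if w < 2 then n - (tetra_index v).+1 + w else (n + tetra_index v + w).-1.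
Proof.
rewrite /tetra_index => n0 va an.
case: (ltnP v n) => vn; last case: (eqVneq v n) => vn'.
- by exists (a - v); [|case: ifP]; lia.
- by exists (a.+1 - n); [|case: ifP]; lia.
- by exists (a.+1 - n - minn (v - n.+1) n.-1); [|case: ifP]; lia.
Qed.

Lemma G_pred_tetra k (x : dhom k (Q n)) : 0 < n -> G_pred (x : simplex (Q n) k) ->
  exists (i : 'I_n) (y : dhom k 3), x = dcomp (tetra i) y.
Proof.
move=> n0 xG; exists (Ordinal (tetra_index_lt (x ord0) n0)).
apply: (dhom_factor (@tetra_inj _)) => l.
have xln : x l < n + n.+2 by rewrite -addSnnS; exact: ltn_ord.
have [w w4 xw] := tetra_index_vertex n0 (G_pred_between l xG) xln.
by exists (Ordinal w4); apply: ord_inj; rewrite tetraE xw.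
Qed.

(** A simplex of the spine of [[n]] is a degeneracy of a face of some
    [spine_edge], whose image under [Q] is a tetrahedron. *)
Lemma tetras_all k (x : simplex (Q n) k) : 0 < n ->
  tetras_pred n x = Qimg_pred (@G_pred n) x.
Proof.
move=> n0; apply/asboolP/asboolP => [H|[m [d [y [dG ->]]]]].
  suff [i [y ->]] : exists (i : 'I_n) (y : dhom k 3), x = dcomp (tetra i) y.
    exists 1, (spine_edge i), y; split=> //.
    by rewrite /G_pred !spine_edgeE /=; lia.
  by case: H => [/(G_pred_tetra n0) // |[i [y [_ ->]]]]; exists i, y.
have [i [e ->]] := G_pred_spine_edge n0 dG.
by right; exists i, (dcomp (fmap Q e) y); split=> //; rewrite fmap_comp dcompA.
Qed.

End Spine.

Lemma Kan_equivalence_eqpred (X : sset) (P P' : forall n, pred (X n)) (HP : sub_closed P)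
    (HP' : sub_closed P') (W : sspace) : (forall n x, P n x = P' n x) ->
  Kan_equivalence (maps_pre (ssub_incl HP) W) -> Kan_equivalence (maps_pre (ssub_incl HP') W).
Proof.
move=> PP'; have E : P = P'.
  by apply: functional_extensionality_dep => n; apply: funext => x; exact: PP'.
by case: _ / E HP' => HP'; rewrite (Prop_irrelevance HP HP').
Qed.

(** The tetrahedra are attached one after the other to the spine of [[2n+1]], and
    each of them meets what precedes exactly in its own spine, by [tetra_next] and
    [tetra_meet]. Each step is thus a pullback of the Segal map of [W_3], and
    two-out-of-three compares it with the Segal map of [W_{2n+1}]. *)
Lemma tetras_Kan_equivalence (W : sspace) (hW : Segal_space W) n j : 0 < n -> j <= n ->
  Kan_equivalence (maps_pre (ssub_incl (@tetras_closed n j)) W).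
Proof.
case: hW => RW SW n0.
have sW k : 2 <= k -> Kan_equivalence (maps_pre (ssub_incl (@G_closed k)) W).
  by move=> /SW /Map_Kan_equivalence.
elim: j => [_|j IH jn].
  apply: (Kan_equivalence_eqpred (HP := @G_closed (Q n))) (sW (Q n) _).
    by move=> k x; rewrite tetras0.
  by rewrite /= /join_obj; lia.
pose o : 'I_n := Ordinal jn.
pose incl := ssub_cor (@tetras_closed n j.+1) (f := ssub_incl (@tetras_closed n j))
  (fun k x => tetras_step (svalP x)).
pose cell := ssub_cor (@tetras_closed n j.+1) (f := simplex_map (tetra o))
  (fun k y => tetras_cell o y).
pose t := ssub_cor (@tetras_closed n j)
  (f := smap_comp (simplex_map (tetra o)) (ssub_incl (@G_closed 3)))
  (fun k y => @tetra_next n o k _ (svalP y)).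
have po : pushout (ssub_incl (@G_closed 3)) t cell incl.
  split.
  - by move=> k y; apply: (@ssub_ext _ _ (@tetras_closed n j.+1)).
  - by move=> k x y /(congr1 sval) /= xy; apply: (@ssub_ext _ _ (@tetras_closed n j)).
  - by move=> k x y /(congr1 sval); exact: dcomp_injl (@tetra_inj _ o).
  - move=> k z; case/asboolP: (svalP z) => [zG|[i [y [ij zE]]]].
      have zP : tetras_pred j (sval z) by apply/asboolP; left.
      by left; exists (exist _ (sval z) zP); apply: (@ssub_ext _ _ (@tetras_closed n j.+1)).
    move: ij; rewrite ltnS leq_eqVlt => /orP[/eqP ij|ij].
      right; exists y; apply: (@ssub_ext _ _ (@tetras_closed n j.+1)).
      by rewrite zE; have -> : i = o by exact: ord_inj.
    have zP : tetras_pred j (sval z) by apply/asboolP; right; exists i, y.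
    by left; exists (exist _ (sval z) zP); apply: (@ssub_ext _ _ (@tetras_closed n j.+1)).
  - move=> k x y /(congr1 sval) xy.
    have yG : G_pred (y : simplex 3 k).
      apply: (@tetra_meet n o).
      have <- : sval x = dcomp (tetra o) y by exact: xy.
      exact: (svalP x).
    by exists (exist _ y yG).
have step : Kan_equivalence (maps_pre incl W).
  apply/shrinkable_Kan_equivalence/(pushout_shrinkable po).
  apply: Kan_equivalence_shrinkable; [exact: Reedy_Kan_complex..| |exact: sW].
  exact/(Reedy_mono RW)/ssub_incl_mono.
apply: Kan_equivalence_cancel_post step _.
have -> : smap_comp (maps_pre incl W) (maps_pre (ssub_incl (@tetras_closed n j.+1)) W) =
  maps_pre (ssub_incl (@tetras_closed n j)) W.
  by apply: smap_ext => l h; exact: smap_ext.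
exact/IH/ltnW.
Qed.

(** * The Segal property of the twisted arrow construction *)

Theorem proposition4p5 (W : sspace) (hW : Segal_space W) : Segal_space (Tw W).
Proof.
split=> n.
  have KW : Kan_fibration (maps_pre (ssub_incl (@Qimg_closed n (@bdry_pred n))) W).
    exact/(Reedy_mono hW.1)/ssub_incl_mono.
  apply: (Map_Kan_fibration _ _).1.
  exact: (Tw_Kan_fibration (@Q_extension_sub n _ (@bdry_closed n)) (Q_extension_simplex n) _ KW).
move=> n2; have n0 : 0 < n by exact: ltnW.
have KW : Kan_equivalence (maps_pre (ssub_incl (@Qimg_closed n (@G_pred n))) W).
  apply: (Kan_equivalence_eqpred (HP := @tetras_closed n n)).
    by move=> k x; exact: tetras_all.
  exact: tetras_Kan_equivalence.
apply: (Map_Kan_equivalence _ _).1.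
exact: (Tw_Kan_equivalence (@Q_extension_sub n _ (@G_closed n)) (Q_extension_simplex n) _ KW).
Qed.
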